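(* The Hochschild cohomology $HH^{-n}(A)$ vanishes for all $n\neq 0,1,2,4$.
   Context: $\mathbf{k}$ is a field of characteristic $0$, $A=\mathbf{k}\langle x,y,z\rangle/(x^2+yx,\,xz,\,zy)$, $A^e=A\otimes A^{\mathrm{op}}$. Hochschild cohomology is placed in non-positive degrees: $HH^{-n}(A)=\mathrm{Ext}^n_{A^e}(A,A)$. *)

(* Defs.v *)
From HB Require Import structures.
From mathcomp Require Import all_boot all_algebra.
From mathcomp Require Import generic_quotient ring_quotient finmap.
From mathcomp Require Import boolp.
From mathcomp Require Export monalg.

Set Implicit Arguments.
Unset Strict Implicit.
Unset Printing Implicit Defensive.

Import GRing.Theory.
Local Open Scope ring_scope.
Local Open Scope quotient_scope.

Section TwoSidedIdeal.
Variables (R : pzRingType) (S : R -> Prop).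

Inductive ideal_gen : R -> Prop :=
| ideal_gen0 : ideal_gen 0
| ideal_genD u v : ideal_gen u -> ideal_gen v -> ideal_gen (u + v)
| ideal_genM x r y : S r -> ideal_gen (x * r * y).

Lemma ideal_gen_mull x u : ideal_gen u -> ideal_gen (x * u).
Proof.
elim=> [|v w _ Iv _ Iw|y r z Sr].
- by rewrite mulr0; apply: ideal_gen0.
- by rewrite mulrDr; apply: ideal_genD.
- by rewrite !mulrA; apply: ideal_genM.
Qed.

Lemma ideal_gen_mulr u x : ideal_gen u -> ideal_gen (u * x).
Proof.
elim=> [|v w _ Iv _ Iw|y r z Sr].
- by rewrite mul0r; apply: ideal_gen0.
- by rewrite mulrDl; apply: ideal_genD.
- by rewrite -!mulrA mulrA; apply: ideal_genM.
Qed.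

Definition ideal_pred : {pred R} := fun x => `[< ideal_gen x >].

Lemma ideal_predP x : reflect (ideal_gen x) (x \in ideal_pred).
Proof. exact: asboolP. Qed.

Lemma ideal_pred_zmod_closed : zmod_closed ideal_pred.
Proof.
split=> [|u v /ideal_predP Iu /ideal_predP Iv]; apply/ideal_predP.
  exact: ideal_gen0.
by apply: ideal_genD => //; rewrite -mulN1r; apply: ideal_gen_mull.
Qed.

HB.instance Definition _ :=
  GRing.isZmodClosed.Build R ideal_pred ideal_pred_zmod_closed.

(* MathComp equips {quot I} with a ring structure only for commutative rings. *)
Definition quot_ring : Type := Quotient.quot ideal_pred.

HB.instance Definition _ : EqQuotient R (Quotient.equiv ideal_pred) quot_ring :=
  EqQuotient.on quot_ring.
HB.instance Definition _ := GRing.Zmodule.on quot_ring.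

Lemma quot_ring_eqP x y :
  reflect (\pi_quot_ring x = \pi_quot_ring y) (x - y \in ideal_pred).
Proof. by rewrite Quotient.idealrBE; apply: eqP. Qed.

Lemma quot_ring_repr x :
  ideal_gen (repr (\pi_quot_ring x) - x).
Proof. by apply/ideal_predP/quot_ring_eqP; rewrite reprK. Qed.

Lemma quot_pi_add : {morph \pi_quot_ring : x y / x + y}.
Proof. by move=> x y; rewrite !piE. Qed.

Definition quot_one : quot_ring := \pi_quot_ring 1.
Definition quot_mul := lift_op2 quot_ring *%R.

Lemma quot_pi_mul x y :
  quot_mul (\pi_quot_ring x) (\pi_quot_ring y) = \pi_quot_ring (x * y).
Proof.
unlock quot_mul; apply/quot_ring_eqP/ideal_predP; set x' := repr _; set y' := repr _.
rewrite -[x' * y'](addrNK (x * y')) -mulrBl -addrA -mulrBr.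
apply: ideal_genD; first exact/ideal_gen_mulr/quot_ring_repr.
exact/ideal_gen_mull/quot_ring_repr.
Qed.

Lemma quot_mulA : associative quot_mul.
Proof.
by move=> u v w; rewrite -[u]reprK -[v]reprK -[w]reprK !quot_pi_mul mulrA.
Qed.
Lemma quot_mul1 : left_id quot_one quot_mul.
Proof. by move=> u; rewrite -[u]reprK quot_pi_mul mul1r. Qed.
Lemma quot_mulr1 : right_id quot_one quot_mul.
Proof. by move=> u; rewrite -[u]reprK quot_pi_mul mulr1. Qed.
Lemma quot_mulDl : left_distributive quot_mul +%R.
Proof.
move=> u v w; rewrite -[u]reprK -[v]reprK -[w]reprK.
by rewrite -quot_pi_add !quot_pi_mul -quot_pi_add mulrDl.
Qed.
Lemma quot_mulDr : right_distributive quot_mul +%R.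
Proof.
move=> u v w; rewrite -[u]reprK -[v]reprK -[w]reprK.
by rewrite -quot_pi_add !quot_pi_mul -quot_pi_add mulrDr.
Qed.

HB.instance Definition _ := GRing.Zmodule_isPzRing.Build quot_ring
  quot_mulA quot_mul1 quot_mulr1 quot_mulDl quot_mulDr.

End TwoSidedIdeal.

Section QuotientModule.
Variables (k : pzRingType) (R : algType k) (S : R -> Prop).
Notation Q := (quot_ring S).

Definition quot_scale (c : k) : Q -> Q := lift_op1 Q ( *:%R c).

Lemma quot_pi_scale c x : quot_scale c (\pi_Q x) = \pi_Q (c *: x).
Proof.
unlock quot_scale; apply/quot_ring_eqP/ideal_predP.
rewrite -scalerBr -[_ - _]mul1r scalerAl.
exact/ideal_gen_mull/quot_ring_repr.
Qed.

Lemma quot_scalerA c c' u :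
  quot_scale c (quot_scale c' u) = quot_scale (c * c') u.
Proof. by rewrite -[u]reprK !quot_pi_scale scalerA. Qed.
Lemma quot_scale1r : left_id 1 quot_scale.
Proof. by move=> u; rewrite -[u]reprK quot_pi_scale scale1r. Qed.
Lemma quot_scalerDr : right_distributive quot_scale +%R.
Proof.
move=> c u v; rewrite -[u]reprK -[v]reprK.
by rewrite -quot_pi_add !quot_pi_scale -quot_pi_add scalerDr.
Qed.
Lemma quot_scalerDl u : {morph quot_scale^~ u : c c' / c + c'}.
Proof.
move=> c c'; rewrite -[u]reprK.
by rewrite !quot_pi_scale -quot_pi_add scalerDl.
Qed.

HB.instance Definition _ := GRing.Zmodule_isLmodule.Build k Q
  quot_scalerA quot_scale1r quot_scalerDr quot_scalerDl.

Lemma quot_scalerAl (c : k) (u v : Q) : c *: (u * v) = (c *: u) * v.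
Proof.
rewrite -[u]reprK -[v]reprK [LHS](congr1 _ (quot_pi_mul _ _ _)).
by rewrite [LHS]quot_pi_scale scalerAl -quot_pi_mul -quot_pi_scale.
Qed.

Lemma quot_scalerAr (c : k) (u v : Q) : c *: (u * v) = u * (c *: v).
Proof.
rewrite -[u]reprK -[v]reprK [LHS](congr1 _ (quot_pi_mul _ _ _)).
by rewrite [LHS]quot_pi_scale scalerAr -quot_pi_mul -quot_pi_scale.
Qed.

End QuotientModule.

Section MalgAlgebra.
Variables (K : monomType) (R : comNzRingType).

Lemma malg_scaleAr (c : R) (g h : {malg R[K]}) : c *: (g * h) = g * (c *: h).
Proof.
suff mulgC (u : {malg R[K]}) : u * malgC c = c *: u
  by rewrite -!mul_malgC !mulrA mulgC mul_malgC.
rewrite malgM_def fgmulgU malgZ_def; apply: eq_bigr => i _.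
by rewrite mulm1 mulrC.
Qed.

End MalgAlgebra.

HB.lock Definition malg_lift (K : choiceType) (R : comNzRingType)
    (V : lmodType R) (f : K -> V) (g : {malg R[K]}) : V :=
  \sum_(x <- msupp g) g@_x *: f x.
Canonical malg_lift_unlockable := Unlockable malg_lift.unlock.

Section LinearExtension.
Variables (K : choiceType) (R : comNzRingType) (V : lmodType R) (f : K -> V).

Local Notation malg_lift := (malg_lift f).

Lemma malg_liftE g : malg_lift g = \sum_(x <- msupp g) g@_x *: f x.
Proof. by rewrite unlock. Qed.

Lemma malg_liftEw (d : {fset K}) g :
  (msupp g `<=` d)%fset -> malg_lift g = \sum_(x <- d) g@_x *: f x.
Proof.
move=> le_gd; rewrite malg_liftE; apply: (big_fset_incl _ le_gd) => x _ /mcoeff_outdom ->.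
by rewrite scale0r.
Qed.

Lemma malg_lift_is_linear : linear malg_lift.
Proof.
move=> c g h; pose d := (msupp g `|` msupp h `|` msupp (c *: g + h))%fset.
have [gd hd ghd] : [/\ msupp g `<=` d, msupp h `<=` d
    & msupp (c *: g + h)%R `<=` d]%fset.
  by split; apply/fsubsetP=> x; rewrite !inE => ->; rewrite ?orbT.
rewrite (malg_liftEw gd) (malg_liftEw hd) (malg_liftEw ghd) scaler_sumr.
rewrite -big_split; apply: eq_bigr => x _ /=.
by rewrite mcoeffD mcoeffZ scalerDl scalerA.
Qed.

HB.instance Definition _ :=
  GRing.isLinear.Build R {malg R[K]} V *:%R malg_lift malg_lift_is_linear.

Lemma malg_liftU x : malg_lift << x >> = f x.
Proof. by rewrite (malg_liftEw msuppU_le) big_seq_fset1 mcoeffUU scale1r. Qed.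

End LinearExtension.

Lemma malg_ind (K : choiceType) (R : comNzRingType) (P : {malg R[K]} -> Prop) :
  P 0 -> (forall c g h, P g -> P h -> P (c *: g + h)) ->
  (forall x, P << x >>) -> forall g, P g.
Proof.
move=> P0 PD PU g; rewrite (monalgE g); elim/big_ind: _ => [//|u v Pu Pv|x _].
  by rewrite -[u]scale1r; apply: PD.
have -> : << g@_x *g x >> = g@_x *: << x >> + 0 :> {malg R[K]}.
  rewrite addr0; apply/malgP=> y.
  by rewrite mcoeffZ !mcoeffU mulr_natr.
exact: PD.
Qed.

Section TensorProduct.
Variables (k : comNzRingType) (A B : algType k).

(* k[A x B], the monoid algebra of the multiplicative monoid of A x B; monalg
   only covers monoids without nontrivial units (monomType). *)
Definition pair_alg : Type := {malg k[(A * B)%type]}.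

HB.instance Definition _ := GRing.Lmodule.on pair_alg.

Definition pure (a : A) (b : B) : pair_alg := << (a, b) >>.

Definition pair_mul (g h : pair_alg) : pair_alg :=
  malg_lift (fun u => malg_lift (fun v => pure (u.1 * v.1) (u.2 * v.2)) h) g.

Lemma pair_mul_pure a b a' b' :
  pair_mul (pure a b) (pure a' b') = pure (a * a') (b * b').
Proof. by rewrite /pair_mul !malg_liftU. Qed.

Lemma pair_mulPl c g g' h :
  pair_mul (c *: g + g') h = c *: pair_mul g h + pair_mul g' h.
Proof. exact: linearP. Qed.

Lemma pair_mulPr c g h h' :
  pair_mul g (c *: h + h') = c *: pair_mul g h + pair_mul g h'.
Proof.
rewrite /pair_mul !malg_liftE scaler_sumr -big_split; apply: eq_bigr => u _ /=.
by rewrite linearP scalerDr !scalerA mulrC.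
Qed.

Lemma pair_mul0l g : pair_mul 0 g = 0. Proof. exact: linear0. Qed.
Lemma pair_mul0r g : pair_mul g 0 = 0.
Proof.
by have := pair_mulPr (-1) g 0 0; rewrite !scaleN1r !addNr.
Qed.

Lemma pair_mulA : associative pair_mul.
Proof.
move=> g h l; elim/malg_ind: l => [|c l l' IHl IHl'|[a'' b'']].
- by rewrite !pair_mul0r.
- by rewrite !pair_mulPr IHl IHl'.
elim/malg_ind: h => [|c h h' IHh IHh'|[a' b']].
- by rewrite !(pair_mul0l, pair_mul0r).
- by rewrite !(pair_mulPl, pair_mulPr) IHh IHh'.
elim/malg_ind: g => [|c g g' IHg IHg'|[a b]].
- by rewrite !pair_mul0l.
- by rewrite !pair_mulPl IHg IHg'.
by rewrite -!/(pure _ _) !pair_mul_pure !mulrA.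
Qed.

Lemma pair_mul1 : left_id (pure 1 1) pair_mul.
Proof.
elim/malg_ind=> [|c g g' IHg IHg'|[a b]]; first by rewrite pair_mul0r.
  by rewrite pair_mulPr IHg IHg'.
by rewrite -/(pure a b) pair_mul_pure !mul1r.
Qed.

Lemma pair_mulr1 : right_id (pure 1 1) pair_mul.
Proof.
elim/malg_ind=> [|c g g' IHg IHg'|[a b]]; first by rewrite pair_mul0l.
  by rewrite pair_mulPl IHg IHg'.
by rewrite -/(pure a b) pair_mul_pure !mulr1.
Qed.

Lemma pair_mulDl : left_distributive pair_mul +%R.
Proof.
by move=> g g' h; rewrite -[g in LHS]scale1r pair_mulPl scale1r.
Qed.

Lemma pair_mulDr : right_distributive pair_mul +%R.
Proof.
by move=> g h h'; rewrite -[h in LHS]scale1r pair_mulPr scale1r.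
Qed.

HB.instance Definition _ := GRing.Zmodule_isPzRing.Build pair_alg
  pair_mulA pair_mul1 pair_mulr1 pair_mulDl pair_mulDr.

(* The linear span of these elements is already a two-sided ideal. *)
Variant tensor_rel : pair_alg -> Prop :=
| TensorDl a a' b :
    tensor_rel (pure (a + a') b - (pure a b + pure a' b))
| TensorDr a b b' :
    tensor_rel (pure a (b + b') - (pure a b + pure a b'))
| TensorZl c a b : tensor_rel (pure (c *: a) b - c *: pure a b)
| TensorZr c a b : tensor_rel (pure a (c *: b) - c *: pure a b).

Definition tensor : Type := quot_ring tensor_rel.
HB.instance Definition _ := GRing.PzRing.on tensor.

Definition tens (a : A) (b : B) : tensor := \pi_(quot_ring tensor_rel) (pure a b).

End TensorProduct.

Section Opposite.
Variables (k : comNzRingType) (A : algType k).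

HB.instance Definition _ := GRing.Zmodule_isLmodule.Build k A^c
  (@scalerA k A) (@scale1r k A) (@scalerDr k A) (@scalerDl k A).

Lemma converse_scaleAl (c : k) (a b : A^c) : c *: (a * b) = (c *: a) * b.
Proof. exact: (@scalerAr k A). Qed.
HB.instance Definition _ := GRing.Lmodule_isLalgebra.Build k A^c
  converse_scaleAl.

Lemma converse_scaleAr (c : k) (a b : A^c) : c *: (a * b) = a * (c *: b).
Proof. exact: (@scalerAl k A). Qed.
HB.instance Definition _ := GRing.Lalgebra_isAlgebra.Build k A^c
  converse_scaleAr.

End Opposite.

Section Enveloping.
Variables (k : comNzRingType) (A : algType k).

Definition enveloping : Type := tensor A A^c.
HB.instance Definition _ := GRing.PzRing.on enveloping.

(* A as a left module over A (x) A^op, with (a (x) b) . m = a m b. *)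
Definition regular_bimodule : Type := A.
HB.instance Definition _ := GRing.Zmodule.on regular_bimodule.

Definition pair_act (g : pair_alg A A^c) (m : A) : A :=
  malg_lift (fun u => u.1 * m * (u.2 : A)) g.

Lemma pair_act_pure a b m : pair_act (pure a b) m = a * m * (b : A).
Proof. by rewrite /pair_act malg_liftU. Qed.

Lemma pair_actPl c g g' m :
  pair_act (c *: g + g') m = c *: pair_act g m + pair_act g' m.
Proof. exact: linearP. Qed.

Lemma pair_actDl g g' m : pair_act (g + g') m = pair_act g m + pair_act g' m.
Proof. exact: linearD. Qed.

Lemma pair_act0l m : pair_act 0 m = 0.
Proof. exact: linear0. Qed.

Lemma pair_actBl g g' m : pair_act (g - g') m = pair_act g m - pair_act g' m.
Proof. exact: linearB. Qed.

Lemma pair_actZl c g m : pair_act (c *: g) m = c *: pair_act g m.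
Proof. exact: linearZ. Qed.

Lemma pair_actPr c g m m' :
  pair_act g (c *: m + m') = c *: pair_act g m + pair_act g m'.
Proof.
rewrite /pair_act !malg_liftE scaler_sumr -big_split; apply: eq_bigr => u _ /=.
rewrite mulrDr mulrDl scalerDr -scalerAr -scalerAl !scalerA.
by rewrite [c * _]mulrC.
Qed.

Lemma pair_actDr g m m' : pair_act g (m + m') = pair_act g m + pair_act g m'.
Proof. by rewrite -[m in LHS]scale1r pair_actPr scale1r. Qed.

Lemma pair_act0 g : pair_act g 0 = 0.
Proof. by apply: (addIr (pair_act g 0)); rewrite -pair_actDr !add0r. Qed.

Lemma pair_actM g h m : pair_act (g * h) m = pair_act g (pair_act h m).
Proof.
elim/malg_ind: h => [|c h h' IHh IHh'|[a' b']].
- by rewrite mulr0 !pair_act0l pair_act0.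
- by rewrite [_ * _]pair_mulPr !pair_actPl pair_actPr IHh IHh'.
elim/malg_ind: g => [|c g g' IHg IHg'|[a b]].
- by rewrite mul0r !pair_act0l.
- by rewrite [X in pair_act X _ = _]pair_mulPl !pair_actPl IHg IHg'.
by rewrite -!/(pure _ _) [_ * _]pair_mul_pure !pair_act_pure !mulrA.
Qed.

Lemma pair_act_ideal g m : ideal_gen (@tensor_rel k A A^c) g -> pair_act g m = 0.
Proof.
elim=> [|u v _ IHu _ IHv|x r y].
- exact: pair_act0l.
- by rewrite pair_actDl IHu IHv addr0.
move=> Sr; rewrite !pair_actM -[RHS](pair_act0 x); congr pair_act.
move: (pair_act y m) => {}m.
by case: Sr => [a a' b|a b b'|c a b|c a b];
  rewrite pair_actBl ?pair_actDl ?pair_actZl !pair_act_pure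
    ?(mulrDl, mulrDr) -?(scalerAl, scalerAr) subrr.
Qed.

Definition bimodule_act (e : enveloping) (m : regular_bimodule) :
  regular_bimodule := pair_act (repr (e : quot_ring (@tensor_rel k A A^c))) m.

Lemma bimodule_act_pi g m :
  bimodule_act (\pi_(quot_ring (@tensor_rel k A A^c)) g) m = pair_act g m.
Proof.
apply/eqP; rewrite -subr_eq0 -pair_actBl; apply/eqP/pair_act_ideal.
exact: quot_ring_repr.
Qed.

Lemma bimodule_act_tens (a : A) (b : A^c) (m : A) :
  bimodule_act (tens a b) m = a * m * (b : A).
Proof. by rewrite bimodule_act_pi pair_act_pure. Qed.

Lemma bimodule_actA e e' m :
  bimodule_act e (bimodule_act e' m) = bimodule_act (e * e') m.
Proof.
rewrite -[e](@reprK _ (quot_ring _)) -[e'](@reprK _ (quot_ring _)).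
by rewrite !bimodule_act_pi -pair_actM -bimodule_act_pi -quot_pi_mul.
Qed.

Lemma bimodule_act1 : left_id 1 bimodule_act.
Proof. by move=> m; rewrite bimodule_act_pi pair_act_pure mul1r mulr1. Qed.

Lemma bimodule_actDr : right_distributive bimodule_act +%R.
Proof. by move=> e m m'; apply: pair_actDr. Qed.

Lemma bimodule_actDl m : {morph bimodule_act^~ m : e e' / e + e'}.
Proof.
move=> e e'; rewrite -[e](@reprK _ (quot_ring _)) -[e'](@reprK _ (quot_ring _)).
by rewrite !bimodule_act_pi -pair_actDl -bimodule_act_pi quot_pi_add.
Qed.

HB.instance Definition _ := GRing.Zmodule_isLmodule.Build
  enveloping regular_bimodule
  bimodule_actA bimodule_act1 bimodule_actDr bimodule_actDl.

End Enveloping.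

Section Ext.
Variable R : pzRingType.

Definition projective (P : lmodType R) : Prop :=
  forall (M N : lmodType R) (g : {linear M -> N}) (f : {linear P -> N}),
    (forall n, exists m, g m = n) ->
    exists h : {linear P -> M}, forall p, g (h p) = f p.

Record proj_resolution (M : lmodType R) := ProjResolution {
  res_mod : nat -> lmodType R;
  res_d : forall n, {linear res_mod n.+1 -> res_mod n};
  res_aug : {linear res_mod 0 -> M};
  res_proj : forall n, projective (res_mod n);
  res_aug_surj : forall m, exists p, res_aug p = m;
  res_exact0 : forall p, res_aug p = 0 <-> exists q, res_d 0 q = p;
  res_exact : forall n p, res_d n p = 0 <-> exists q, res_d n.+1 q = p
}.

Variables (M N : lmodType R) (P : proj_resolution M).

Definition ext_cocycle n (f : {linear res_mod P n -> N}) : Prop :=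
  forall p, f (res_d P n p) = 0.

Definition ext_coboundary n : {linear res_mod P n -> N} -> Prop :=
  match n with
  | 0 => fun f => forall p, f p = 0
  | n'.+1 => fun f => exists g : {linear res_mod P n' -> N},
      forall p, f p = g (res_d P n' p)
  end.

End Ext.

(* Ext^n_R(M, N) = 0; the groups computed from different projective resolutions
   of M are isomorphic, so every resolution is quantified over. *)
Definition Ext_vanishes (R : pzRingType) (M N : lmodType R) (n : nat) : Prop :=
  forall (P : proj_resolution M) (f : {linear res_mod P n -> N}),
    ext_cocycle f -> ext_coboundary f.

(* HH^{-n}(A) = Ext^n_{A^e}(A, A) = 0, cohomology being placed in non-positive
   degrees. *)
Definition HH_vanishes (k : comNzRingType) (A : algType k) (n : nat) : Prop :=
  @Ext_vanishes (enveloping A) (regular_bimodule A) (regular_bimodule A) n.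

Definition free_alg3 (k : fieldType) : Type := {malg k[{fmonom 'I_3}]}.
HB.instance Definition _ (k : fieldType) := GRing.Lalgebra.on (free_alg3 k).
HB.instance Definition _ (k : fieldType) :=
  GRing.Lalgebra_isAlgebra.Build k (free_alg3 k) (@malg_scaleAr _ k).

HB.lock Definition free_gen (k : fieldType) (i : 'I_3) : free_alg3 k :=
  << fmu i >>.

Section AlgebraA.
Variable k : fieldType.
Local Notation free_alg3 := (free_alg3 k).
Local Notation free_gen := (@free_gen k).

Definition free_x := free_gen (@Ordinal 3 0 isT).
Definition free_y := free_gen (@Ordinal 3 1 isT).
Definition free_z := free_gen (@Ordinal 3 2 isT).

Variant relA : free_alg3 -> Prop :=
| RelXX : relA (free_x ^+ 2 + free_y * free_x)
| RelXZ : relA (free_x * free_z)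
| RelZY : relA (free_z * free_y).

Definition algA : Type := quot_ring relA.
HB.instance Definition _ := GRing.PzRing.on algA.
HB.instance Definition _ := GRing.Lmodule.on algA.

Definition free_aug (u : free_alg3) : k :=
  mcoeff (mone : {fmonom 'I_3}) (u : {malg k[{fmonom 'I_3}]}).

Lemma free_augD u v : free_aug (u + v) = free_aug u + free_aug v.
Proof. exact: mcoeffD. Qed.

Lemma free_augM u v : free_aug (u * v) = free_aug u * free_aug v.
Proof. exact: (rmorphM (@mcoeff {fmonom 'I_3} k mone)). Qed.

Lemma free_aug_gen i : free_aug (free_gen i) = 0.
Proof. by rewrite /free_aug free_gen.unlock mcoeffU1 -val_eqE /= fmuE fm1. Qed.

Lemma free_augMgen u i : free_aug (u * free_gen i) = 0.
Proof. by rewrite free_augM free_aug_gen mulr0. Qed.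

Lemma relA_augmentation u : ideal_gen relA u -> free_aug u = 0.
Proof.
elim=> [|v w _ v0 _ w0|v r w rr]; first exact: mcoeff0.
  by rewrite free_augD v0 w0 addr0.
suff r0 : free_aug r = 0 by rewrite !free_augM r0 mulr0 mul0r.
case: rr; try exact: free_augMgen.
apply: (etrans (free_augD _ _)); rewrite -[RHS]addr0.
by congr (_ + _); apply: free_augMgen.
Qed.

Lemma algA_nonzero : (1 : algA) != 0.
Proof.
apply/eqP => eq10.
have : ideal_gen relA (1 - 0).
  by apply/ideal_predP/quot_ring_eqP; rewrite [LHS]eq10 !piE.
by move/relA_augmentation/eqP; rewrite subr0 /free_aug mcoeff1 eqxx oner_eq0.
Qed.

HB.instance Definition _ := GRing.PzSemiRing_isNonZero.Build algA algA_nonzero.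
HB.instance Definition _ := GRing.Lmodule_isLalgebra.Build k algA
  (@quot_scalerAl k free_alg3 relA).
HB.instance Definition _ := GRing.Lalgebra_isAlgebra.Build k algA
  (@quot_scalerAr k free_alg3 relA).

End AlgebraA.

(* Main.v *)
(** [A] is Koszul: the dual coalgebra has as bases [1] in degree 0, [x, y, z] in
    degree 1, the relations [(x + y)x, xz, zy] in degree 2, [xzy, (x + y)xz] in
    degree 3 and [(x + y)xzy] in degree 4, which gives a complex
    [0 -> E -> E^2 -> E^3 -> E^3 -> E] of free modules over [E = A (x) A^op].
    It is exact because an automaton acting on [A^5] reads off the coefficients
    of the last letters of an element of [A]; these coefficient operators,
    extended to [E], contract the complex up to terms of lower degree in the
    left factor. So only [Ext^3] has to be computed. A cocycle is a pair [(a, b)]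
    with [(x + y) a + b y = 0], and the coefficients of the first letters, read
    off by a second automaton, exhibit it as [(x r - q y, (x + y) q - p z)],
    which is a coboundary. *)
From HB Require Import structures.
Require Import Defs.
From mathcomp Require Import all_boot all_algebra.
From mathcomp Require Import generic_quotient.

Set Implicit Arguments.
Unset Strict Implicit.
Unset Printing Implicit Defensive.

Import GRing.Theory.
Local Open Scope ring_scope.
Local Open Scope quotient_scope.

(** * Kernels, lifting through exact pairs, and projective modules *)

Definition linear_of (R : pzRingType) (U V : lmodType R) (f : U -> V)
    (f_lin : linear f) : {linear U -> V} :=
  HB.pack f (GRing.isLinear.Build R U V *:%R f f_lin).

Section Kernel.
Variables (R : pzRingType) (V W : lmodType R) (d : {linear V -> W}).

Definition ker_pred : {pred V} := fun v => d v == 0.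

Lemma ker_submod_closed : submod_closed ker_pred.
Proof.
split=> [|c u v /eqP du /eqP dv]; rewrite unfold_in ?linear0 //.
by rewrite linearP du dv scaler0 addr0.
Qed.

HB.instance Definition _ :=
  GRing.isSubmodClosed.Build R V ker_pred ker_submod_closed.

(** Making the kernel a module in its own right turns exactness into surjectivity onto [kernel d],
    the form to which [projective] applies. *)
Record kernel := Kernel { kernel_val :> V; _ : kernel_val \in ker_pred }.
HB.instance Definition _ := [isSub for kernel_val].
HB.instance Definition _ := [Choice of kernel by <:].
HB.instance Definition _ := [SubChoice_isSubLmodule of kernel by <:].

End Kernel.

Section Lifting.
Variables (R : pzRingType) (P U V W : lmodType R).
Variables (g : {linear U -> V}) (d : {linear V -> W}).
Hypothesis projP : projective P.
Hypothesis gd_exact : forall v, d v = 0 <-> exists u, g u = v.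

(** Both [f] and [g] corestrict to [kernel d], and exactness makes the corestriction of [g]
    surjective. *)
Lemma proj_lift_exact (f : {linear P -> V}) :
  (forall p, d (f p) = 0) -> exists h : {linear P -> U}, forall p, g (h p) = f p.
Proof.
move=> df0.
have gker u : g u \in ker_pred d.
  by apply/eqP; apply/gd_exact; exists u.
have fker p : f p \in ker_pred d by apply/eqP.
pose g' u : kernel d := Kernel (gker u).
pose f' p : kernel d := Kernel (fker p).
have g'lin : linear g'.
  by move=> c u v; apply: val_inj; apply: linearP.
have f'lin : linear f'.
  by move=> c u v; apply: val_inj; apply: linearP.
have [n|h hE] := @projP _ _ (linear_of g'lin) (linear_of f'lin).
  have [u gu] : exists u, g u = val n by apply/gd_exact/eqP; case: n.
  by exists u; apply: val_inj.
by exists h => p; have /(congr1 val) := hE p.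
Qed.

End Lifting.

Section Regular.
Variable R : pzRingType.
Lemma projective_regular : projective R^o.
Proof.
move=> M N g f g_surj; have [m gm] := g_surj (f 1).
have hlin : linear (fun r : R^o => (r : R) *: m).
  by move=> c u v; rewrite scalerDl scalerA.
exists (linear_of hlin) => p /=; rewrite linearZ /= gm -linearZ /=.
by congr (f _); rewrite -[RHS]mulr1.
Qed.
End Regular.
Section Prod.
Variables (R : pzRingType) (P Q : lmodType R).
Lemma projective_prod : projective P -> projective Q -> projective (P * Q)%type.
Proof.
move=> projP projQ M N g f g_surj.
have linl : linear (fun p : P => f (p, 0)).
  move=> c u v; rewrite -linearP; congr (f _).
  by apply: injective_projections; rewrite //= scaler0 addr0.
have linr : linear (fun q : Q => f (0, q)).
  move=> c u v; rewrite -linearP; congr (f _).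
  by apply: injective_projections; rewrite //= scaler0 addr0.
have [h hE] := projP _ _ g (linear_of linl) g_surj.
have [h' hE'] := projQ _ _ g (linear_of linr) g_surj.
have hlin : linear (fun u : P * Q => h u.1 + h' u.2).
  by move=> c u v; rewrite /= !linearP scalerDr addrACA.
exists (linear_of hlin).
case=> p q /=; rewrite linearD hE hE' /= -linearD; congr (f _).
by apply: injective_projections; rewrite /= ?addr0 ?add0r.
Qed.
End Prod.

(** Serves the zero terms of the Koszul resolution beyond degree 4. *)
Lemma projective_trivial (R : pzRingType) (P : lmodType R) :
  (forall p : P, p = 0) -> projective P.
Proof.
move=> P0 M N g f _; exists \0 => p.
by rewrite (P0 p) !linear0.
Qed.

(** * Comparison of two projective resolutions *)

Section Comparison.
Variables (R : pzRingType) (M N : lmodType R) (K P : proj_resolution M).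

Lemma res_dd (Q : proj_resolution M) n q : res_d Q n (res_d Q n.+1 q) = 0.
Proof. by apply/res_exact; exists q. Qed.

(* [h] is a degree [n] piece of a contraction of [id - phi psi]; the last
   clause is what allows the next piece to be constructed. *)
Lemma comparison n :
  exists (phi : {linear res_mod K n -> res_mod P n})
    (phi' : {linear res_mod K n.+1 -> res_mod P n.+1})
    (psi : {linear res_mod P n -> res_mod K n})
    (psi' : {linear res_mod P n.+1 -> res_mod K n.+1})
    (h : {linear res_mod P n -> res_mod P n.+1}),
  [/\ forall x, res_d P n (phi' x) = phi (res_d K n x),
      forall x, res_d K n (psi' x) = psi (res_d P n x)
    & forall p, res_d P n (p - phi' (psi' p) - h (res_d P n p)) = 0].
Proof.
elim: n => [|n [phi [phi' [psi [psi' [h [phiE psiE hE]]]]]]].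
  have [phi phiE] := res_proj (res_aug K) (@res_aug_surj _ _ P).
  have [psi psiE] := res_proj (res_aug P) (@res_aug_surj _ _ K).
  have [|phi' phiE'] := @proj_lift_exact _ _ _ _ _ _ _ (@res_proj _ _ K 1)
     (@res_exact0 _ _ P) (phi \o res_d K 0 : {linear _ -> _}).
    by move=> x /=; rewrite phiE; apply/res_exact0; exists x.
  have [|psi' psiE'] := @proj_lift_exact _ _ _ _ _ _ _ (@res_proj _ _ P 1)
     (@res_exact0 _ _ K) (psi \o res_d P 0 : {linear _ -> _}).
    by move=> x /=; rewrite psiE; apply/res_exact0; exists x.
  (* [phi \o psi] covers the identity of [M], so its difference from the identity is killed by the
     augmentation and lifts to [h]. *)
  have [|h hE] := @proj_lift_exact _ _ _ _ _ _ _ (@res_proj _ _ P 0)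
     (@res_exact0 _ _ P) (idfun \- (phi \o psi) : {linear _ -> _}).
    by move=> x /=; rewrite linearB /= phiE psiE subrr.
  exists phi, phi', psi, psi', h; split=> // p.
  by rewrite !linearB /= hE phiE' /= psiE' /= subrr.
have [|phi'' phiE'] := @proj_lift_exact _ _ _ _ _ _ _ (@res_proj _ _ K n.+2)
   (@res_exact _ _ P n) (phi' \o res_d K n.+1 : {linear _ -> _}).
  by move=> x /=; rewrite phiE res_dd linear0.
have [|psi'' psiE'] := @proj_lift_exact _ _ _ _ _ _ _ (@res_proj _ _ P n.+2)
   (@res_exact _ _ K n) (psi' \o res_d P n.+1 : {linear _ -> _}).
  by move=> x /=; rewrite psiE res_dd linear0.
have [|h' hE'] := @proj_lift_exact _ _ _ _ _ _ _ (@res_proj _ _ P n.+1)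
   (@res_exact _ _ P n) (idfun \- (phi' \o psi') \- (h \o res_d P n) : {linear _ -> _}).
  exact: hE.
exists phi', phi'', psi', psi'', h'; split=> // p.
by rewrite !linearB /= hE' phiE' /= psiE' /= res_dd linear0 subr0 subrr.
Qed.

(** Since [Ext_vanishes] ranges over all resolutions, this allows a single one to be computed. Up to
    a boundary, on which [f] vanishes, [p] equals [phi' (psi' p) + h (d p)]. As [f \o phi'] is
    [g \o d] for some [g], and [psi'] commutes with the differentials, [f] is
    [(g \o psi + f \o h) \o d]. *)
Lemma ext_vanishing_transfer n :
  (forall g : {linear res_mod K n.+1 -> N},
    ext_cocycle g -> ext_coboundary g) ->
  forall f : {linear res_mod P n.+1 -> N}, ext_cocycle f -> ext_coboundary f.
Proof.
move=> K0 f fd0.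
have [phi [phi' [psi [psi' [h [phiE psiE hE]]]]]] := comparison n.
have [|phi'' phiE'] := @proj_lift_exact _ _ _ _ _ _ _ (@res_proj _ _ K n.+2)
   (@res_exact _ _ P n) (phi' \o res_d K n.+1 : {linear _ -> _}).
  by move=> x /=; rewrite phiE res_dd linear0.
have [|g gE] := K0 (f \o phi' : {linear _ -> _}).
  by move=> x; rewrite /= -[phi' _]phiE' fd0.
exists ((g \o psi) \+ (f \o h) : {linear _ -> _}) => p /=.
have [q qE] : exists q, res_d P n.+1 q = p - phi' (psi' p) - h (res_d P n p).
  exact/res_exact.
rewrite -psiE -gE /= -linearD.
have pE : p = res_d P n.+1 q + (phi' (psi' p) + h (res_d P n p)).
  by rewrite qE addrA addrAC subrK subrK.
rewrite (congr1 f pE) (linearD f (res_d P n.+1 q)) -[RHS]add0r.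
by congr (_ + _); apply: fd0.
Qed.

End Comparison.

(** * The presentation of [A] and automata acting through it *)

Section Presentation.
Variable k : fieldType.
Local Notation A := (algA k).
Local Notation free := (free_alg3 k).

Local Notation proj := (\pi_(quot_ring (@relA k))%qT : free -> A).

Definition genA (i : 'I_3) : A := proj (free_gen k i).

Lemma algA_reprE (a : A) : exists u : free, a = proj u.
Proof. by exists (repr (a : quot_ring (@relA k))); rewrite reprK. Qed.

Lemma projM u v : proj (u * v) = proj u * proj v.
Proof. exact/esym/quot_pi_mul. Qed.

Lemma projP c u v : proj (c *: u + v) = c *: proj u + proj v.
Proof. by rewrite quot_pi_add -[proj (c *: u)]quot_pi_scale. Qed.

Lemma proj0 : proj 0 = 0.
Proof. by have := projP (-1) 0 0; rewrite scaler0 addr0 scaleN1r addNr. Qed.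

Lemma proj_rel r : relA r -> proj r = 0.
Proof.
move=> rr; rewrite -proj0; apply/quot_ring_eqP/ideal_predP; rewrite subr0.
by rewrite -[r]mulr1 -[r]mul1r; apply: ideal_genM.
Qed.

Definition mon (s : seq 'I_3) : free := << FMonom s >>.

Lemma monM s t : mon (s ++ t) = mon s * mon t.
Proof.
rewrite /mon [RHS]malgM_def fgmulUU mulr1; congr << _ *g _ >>.
by apply: val_inj; rewrite [RHS]fmM.
Qed.

Lemma mon1 : mon [::] = 1.
Proof.
by rewrite /mon; congr << _ *g _ >>; apply: val_inj; rewrite [RHS]fm1.
Qed.

Lemma mon_gen i : mon [:: i] = free_gen k i.
Proof. by rewrite free_gen.unlock fmuE. Qed.

Lemma free_ind (P : free -> Prop) :
  (forall c u v, P u -> P v -> P (c *: u + v)) -> (forall s, P (mon s)) ->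
  forall u, P u.
Proof.
move=> PD Pm; apply: malg_ind => [|//|[s]]; last exact: Pm.
(* The zero element is obtained as [(-1) *: 1 + 1], where [1] is the empty word. *)
by have := PD (-1) 1 1; rewrite scaleN1r addNr -mon1; apply; apply: Pm.
Qed.

Lemma algA_rind (P : A -> Prop) :
  (forall c a b, P a -> P b -> P (c *: a + b)) -> P 1 ->
  (forall a i, P a -> P (a * genA i)) -> forall a, P a.
Proof.
move=> PD P1 PM a; have [u ->] := algA_reprE a.
elim/free_ind: u => [c u v Pu Pv|s]; first by rewrite projP; apply: PD.
elim/last_ind: s => [|s i Ps]; first by rewrite mon1.
by rewrite -cats1 monM projM mon_gen; apply: PM.
Qed.

Lemma algA_lind (P : A -> Prop) :
  (forall c a b, P a -> P b -> P (c *: a + b)) -> P 1 ->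
  (forall a i, P a -> P (genA i * a)) -> forall a, P a.
Proof.
move=> PD P1 PM a; have [u ->] := algA_reprE a.
elim/free_ind: u => [c u v Pu Pv|s]; first by rewrite projP; apply: PD.
elim: s => [|i s Ps]; first by rewrite mon1.
by rewrite -cat1s monM projM mon_gen; apply: PM.
Qed.

Section Action.
Variables (left : bool) (V : lmodType k) (op : 'I_3 -> {linear V -> V}).

(** A left action applies the last letter first, hence the reversal; a right action applies the
    first letter first. *)
Definition word_act (s : seq 'I_3) (v : V) : V :=
  foldl (fun v i => op i v) v (if left then rev s else s).

Lemma word_act_cat s t v : word_act (s ++ t) v =
  if left then word_act s (word_act t v) else word_act t (word_act s v).
Proof. by rewrite /word_act; case: left; rewrite ?rev_cat foldl_cat. Qed.

Lemma word_actP c s v w :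
  word_act s (c *: v + w) = c *: word_act s v + word_act s w.
Proof.
rewrite /word_act; elim: (if left then _ else _) v w => //= i t IH v w.
by rewrite linearP IH.
Qed.

Definition free_act (u : free) (v : V) : V :=
  malg_lift (fun w : {fmonom 'I_3} => word_act w v) u.

Lemma free_act_mon s v : free_act (mon s) v = word_act s v.
Proof. by rewrite /free_act malg_liftU. Qed.

Lemma free_actPl c u u' v :
  free_act (c *: u + u') v = c *: free_act u v + free_act u' v.
Proof. exact: linearP. Qed.

Lemma free_act0l v : free_act 0 v = 0.
Proof. exact: linear0. Qed.

Lemma free_actPr c u v w :
  free_act u (c *: v + w) = c *: free_act u v + free_act u w.
Proof.
elim/free_ind: u => [d u u' IH IH'|s]; last by rewrite !free_act_mon word_actP.
by rewrite !free_actPl IH IH' !scalerDr !scalerA addrACA mulrC.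
Qed.

Lemma free_act0r u : free_act u 0 = 0.
Proof.
by have := free_actPr (-1) u 0 0; rewrite scaler0 addr0 scaleN1r addNr.
Qed.

Lemma free_actM u w v : free_act (u * w) v =
  if left then free_act u (free_act w v) else free_act w (free_act u v).
Proof.
elim/free_ind: u => [c u u' IH IH'|s].
  have -> : (c *: u + u') * w = c *: (u * w) + u' * w by rewrite scalerAl mulrDl.
  rewrite (free_actPl c (u * w) (u' * w)) !(free_actPl c u u').
  move: (u * w) (u' * w) IH IH' => p p' -> ->.
  by case: left => //; rewrite free_actPr.
elim/free_ind: w => [c w w' IH IH'|t].
  have -> : mon s * (c *: w + w') = c *: (mon s * w) + mon s * w'.
    by rewrite scalerAr mulrDr.
  rewrite (free_actPl c (mon s * w) (mon s * w')) !(free_actPl c w w').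
  move: (mon s * w) (mon s * w') IH IH' => p p' -> ->.
  by case: left => //; rewrite free_actPr.
by rewrite -monM !free_act_mon word_act_cat; case: left.
Qed.

Lemma free_actD u u' v : free_act (u + u') v = free_act u v + free_act u' v.
Proof. by rewrite -[u in LHS]scale1r free_actPl scale1r. Qed.

Lemma free_act_gen i v : free_act (free_gen k i) v = op i v.
Proof. by rewrite -mon_gen free_act_mon /word_act; case: left. Qed.

Definition pair_word (i j : 'I_3) (v : V) : V :=
  if left then op i (op j v) else op j (op i v).

Lemma free_act_pair i j v :
  free_act (free_gen k i * free_gen k j) v = pair_word i j v.
Proof.
by rewrite (free_actM (free_gen k i)) !(free_act_gen i, free_act_gen j).
Qed.

Local Notation ix := (@Ordinal 3 0 isT).
Local Notation iy := (@Ordinal 3 1 isT).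
Local Notation iz := (@Ordinal 3 2 isT).

Lemma free_act_rel :
  (forall v, pair_word ix ix v + pair_word iy ix v = 0) ->
  (forall v, pair_word ix iz v = 0) -> (forall v, pair_word iz iy v = 0) ->
  forall r v, relA r -> free_act r v = 0.
Proof.
move=> xx0 xz0 zy0 r v [].
- rewrite (free_actD (free_x k ^+ 2)) -[RHS](xx0 v).
  by congr (_ + _); apply: free_act_pair.
- by rewrite -[RHS](xz0 v); apply: free_act_pair.
by rewrite -[RHS](zy0 v); apply: free_act_pair.
Qed.

Hypothesis rel_act0 : forall r v, relA r -> free_act r v = 0.

Lemma ideal_act0 u v : ideal_gen (@relA k) u -> free_act u v = 0.
Proof.
move=> Iu; elim: Iu v => {u} [|u u' _ IH _ IH'|x r y rr] v.
- exact: free_act0l.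
- by rewrite -[u]scale1r free_actPl IH IH' scaler0 addr0.
by rewrite !free_actM; case: left; rewrite (rel_act0 _ rr) ?free_act0r.
Qed.

Variable v0 : V.

(** The automaton started at [v0] and run on a representative of [a]; [state_proj] shows that the
    choice of representative does not matter. *)
Definition state_fun (a : A) : V :=
  free_act (repr (a : quot_ring (@relA k))) v0.

Lemma state_proj u : state_fun (proj u) = free_act u v0.
Proof.
apply/eqP; rewrite -subr_eq0; apply/eqP.
have /(ideal_act0 v0) := quot_ring_repr (@relA k) u.
by rewrite addrC -scaleN1r free_actPl scaleN1r addrC.
Qed.

Lemma state_fun_linear : linear state_fun.
Proof.
move=> c a b; have [u ->] := algA_reprE a; have [w ->] := algA_reprE b.
by rewrite -projP !state_proj free_actPl.
Qed.

Definition state : {linear A -> V} := linear_of state_fun_linear.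

Lemma state1 : state 1 = v0.
Proof. by rewrite /= state_proj -mon1 free_act_mon /word_act; case: left. Qed.

Lemma state_gen i a :
  state (if left then genA i * a else a * genA i) = op i (state a).
Proof.
have [u ->] := algA_reprE a; rewrite /= state_proj /genA.
have -> : (if left then proj (free_gen k i) * proj u else proj u * proj (free_gen k i))
   = proj (if left then free_gen k i * u else u * free_gen k i).
  by case: left; rewrite projM.
rewrite state_proj -free_act_gen.
move: (free_actM (free_gen k i) u v0) (free_actM u (free_gen k i) v0).
by case: left => [E _|_ E]; apply: E.
Qed.

End Action.
End Presentation.

(** * Tensor products and operators on their left factor *)

Section TensorElements.
Variables (k : comNzRingType) (A B : algType k).
Local Notation E := (tensor A B).
Local Notation PA := (pair_alg A B).
Local Notation proj := (\pi_(quot_ring (@tensor_rel k A B)) : PA -> E).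

Lemma pair_scaleAl c (g h : PA) : (c *: g) * h = c *: (g * h).
Proof. by have := pair_mulPl c g 0 h; rewrite Defs.pair_mul0l !addr0. Qed.

Lemma pair_scaleAr c (g h : PA) : g * (c *: h) = c *: (g * h).
Proof. by have := pair_mulPr c g h 0; rewrite Defs.pair_mul0r !addr0. Qed.

Lemma tproj_rel g : tensor_rel g -> proj g = 0.
Proof.
have p0 : proj 0 = 0.
  have := quot_pi_add (@tensor_rel k A B) 0 0; rewrite addr0 => /esym/eqP.
  by rewrite -subr_eq0 addrK => /eqP.
move=> rg; rewrite -p0; apply/quot_ring_eqP/ideal_predP; rewrite subr0.
by rewrite -[g]mulr1 -[g]mul1r; apply: ideal_genM.
Qed.

Lemma tprojD (g h : PA) : proj (g + h) = proj g + proj h.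
Proof. exact: quot_pi_add. Qed.

Lemma tproj0 : proj 0 = 0.
Proof. by apply: (addIr (proj 0)); rewrite -tprojD !add0r. Qed.

Lemma tprojN (g : PA) : proj (- g) = - proj g.
Proof. by apply: (addIr (proj g)); rewrite -tprojD !addNr tproj0. Qed.

Lemma tprojM (g h : PA) : proj (g * h) = proj g * proj h.
Proof. exact/esym/quot_pi_mul. Qed.

Lemma tensDl a a' b : tens (a + a') b = tens a b + tens a' b :> E.
Proof.
apply/eqP; rewrite -subr_eq0; apply/eqP.
by rewrite -(tproj_rel (TensorDl a a' b)) tprojD tprojN tprojD.
Qed.

Lemma tensDr a b b' : tens a (b + b') = tens a b + tens a b' :> E.
Proof.
apply/eqP; rewrite -subr_eq0; apply/eqP.
by rewrite -(tproj_rel (TensorDr a b b')) tprojD tprojN tprojD.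
Qed.

Lemma tprojZl c a b : proj (c *: pure a b) = tens (c *: a) b.
Proof.
apply/esym/eqP; rewrite -subr_eq0; apply/eqP.
by rewrite -(tproj_rel (TensorZl c a b)) tprojD tprojN.
Qed.

Lemma tprojZr c a b : proj (c *: pure a b) = tens a (c *: b).
Proof.
apply/esym/eqP; rewrite -subr_eq0; apply/eqP.
by rewrite -(tproj_rel (TensorZr c a b)) tprojD tprojN.
Qed.

Lemma tprojE a b : proj (pure a b) = tens a b.
Proof. by []. Qed.

Lemma tensZ c a b : tens (c *: a) b = tens a (c *: b) :> E.
Proof. by rewrite -tprojZl -tprojZr. Qed.

Lemma tensM a b a' b' : tens a b * tens a' b' = tens (a * a') (b * b') :> E.
Proof. by rewrite -[LHS]tprojM; congr (proj _); apply: pair_mul_pure. Qed.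

Lemma tens_comm a b : tens 1 b * tens a 1 = tens a 1 * tens 1 b :> E.
Proof. by rewrite !tensM !mulr1 !mul1r. Qed.

Lemma tens_mul1l b b' : tens 1 b * tens 1 b' = tens 1 (b * b') :> E.
Proof. by rewrite tensM mul1r. Qed.

Lemma tens_mulr1 a b b' : tens a b * tens 1 b' = tens a (b * b') :> E.
Proof. by rewrite tensM mulr1. Qed.

Lemma tens_mul1r a b a' : tens a b * tens a' 1 = tens (a * a') b :> E.
Proof. by rewrite tensM mulr1. Qed.

Lemma tens0l b : tens 0 b = 0 :> E.
Proof. by apply: (addIr (tens 0 b)); rewrite -tensDl !add0r. Qed.

Lemma tens0r a : tens a 0 = 0 :> E.
Proof. by apply: (addIr (tens a 0)); rewrite -tensDr !add0r. Qed.

Lemma tensNl a b : tens (- a) b = - tens a b :> E.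
Proof. by apply: (addIr (tens a b)); rewrite -tensDl !addNr tens0l. Qed.

Lemma tensor_ind (P : E -> Prop) :
  (forall e e', P e -> P e' -> P (e + e')) -> (forall a b, P (tens a b)) ->
  forall e, P e.
Proof.
move=> PD Pt e; rewrite -[e](@reprK _ (quot_ring (@tensor_rel k A B))).
(* The induction produces scalar multiples, under which [P] is not assumed stable; quantifying over
   the scalar [c] absorbs them into the left factor. *)
move: (repr _) => g; suff Pc : forall c, P (proj (c *: g)).
  by rewrite -[g]scale1r; apply: Pc.
elim/malg_ind: g => [|d g h IHg IHh|[a b]] c.
- by rewrite scaler0 tproj0 -(tens0l 0).
- by rewrite scalerDr scalerA tprojD; apply: PD.
by rewrite -/(pure a b) tprojZl.
Qed.

Variable T : {linear A -> A}.

Definition pair_map (g : PA) : PA := malg_lift (fun u => pure (T u.1) u.2) g.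

Lemma pair_map_pure a b : pair_map (pure a b) = pure (T a) b.
Proof. by rewrite /pair_map malg_liftU. Qed.

Lemma pair_mapP c g h : pair_map (c *: g + h) = c *: pair_map g + pair_map h.
Proof. exact: linearP. Qed.

Lemma pair_mapD g h : pair_map (g + h) = pair_map g + pair_map h.
Proof. exact: linearD. Qed.

Lemma pair_mapN g : pair_map (- g) = - pair_map g.
Proof. exact: linearN. Qed.

Lemma pair_mapZ c g : pair_map (c *: g) = c *: pair_map g.
Proof. exact: linearZ. Qed.

Lemma tprojZ c (g : PA) : proj g = 0 -> proj (c *: g) = 0.
Proof.
by move=> g0; rewrite -[g]mul1r -pair_scaleAl tprojM g0 mulr0.
Qed.

(** [pair_map] is not multiplicative, so the factors around a relation cannot simply be pulled out.
    They are decomposed into pure tensors instead: a tensor relation multiplied by pure tensors on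
    both sides is again a tensor relation of the same kind, and [T] is linear. *)
Lemma pair_map_ideal g : ideal_gen (@tensor_rel k A B) g -> proj (pair_map g) = 0.
Proof.
elim=> [|u v _ IHu _ IHv|u r v rr].
- by rewrite [pair_map 0]linear0 tproj0.
- by rewrite pair_mapD tprojD IHu IHv addr0.
elim/malg_ind: u => [|c g1 g2 IH1 IH2|[a1 b1]].
- by rewrite !mul0r [pair_map 0]linear0 tproj0.
- have -> : (c *: g1 + g2 : PA) * r * v = c *: ((g1 : PA) * r * v) + (g2 : PA) * r * v.
    by rewrite -!mulrA; apply: pair_mulPl.
  by rewrite pair_mapP tprojD IH2 addr0 tprojZ.
elim/malg_ind: v => [|c g1 g2 IH1 IH2|[a2 b2]].
- by rewrite mulr0 [pair_map 0]linear0 tproj0.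
- have -> (u : PA) : u * (c *: g1 + g2 : PA) = c *: (u * (g1 : PA)) + u * (g2 : PA) by apply: pair_mulPr.
  by rewrite pair_mapP tprojD IH2 addr0 tprojZ.
rewrite -/(pure a1 b1) -/(pure a2 b2).
have pM a b : pure a1 b1 * pure a b * pure a2 b2 = pure (a1 * a * a2) (b1 * b * b2) :> PA.
  by rewrite [pure a1 b1 * _]pair_mul_pure; apply: pair_mul_pure.
have pZ c a b : pure a1 b1 * (c *: pure a b) * pure a2 b2 =
    c *: pure (a1 * a * a2) (b1 * b * b2) :> PA.
  by rewrite -pM pair_scaleAr pair_scaleAl.
case: rr => [a a' b|a b b'|c a b|c a b].
all: rewrite !(mulrBr, mulrDr, mulrBl, mulrDl) ?pM ?pZ.
all: rewrite !(pair_mapD, pair_mapN, pair_mapZ, pair_map_pure).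
all: rewrite !(tprojD, tprojN) ?tprojZl ?tprojE.
- by rewrite mulrDr mulrDl linearD tensDl subrr.
- by rewrite mulrDr mulrDl tensDr subrr.
- by rewrite -scalerAr -scalerAl linearZ subrr.
by rewrite -scalerAr -scalerAl tensZ subrr.
Qed.

(** This is [T (x) id]. *)
Definition tmap (e : E) : E :=
  proj (pair_map (repr (e : quot_ring (@tensor_rel k A B)))).

Lemma tmap_proj g : tmap (proj g) = proj (pair_map g).
Proof.
apply/eqP; rewrite -subr_eq0; apply/eqP.
have /pair_map_ideal := quot_ring_repr (@tensor_rel k A B) g.
by rewrite pair_mapD pair_mapN tprojD tprojN.
Qed.

Lemma tmap_tens a b : tmap (tens a b) = tens (T a) b.
Proof. by rewrite /tens tmap_proj pair_map_pure. Qed.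

Lemma tmapD e e' : tmap (e + e') = tmap e + tmap e'.
Proof.
rewrite -[e](@reprK _ (quot_ring (@tensor_rel k A B))).
rewrite -[e'](@reprK _ (quot_ring (@tensor_rel k A B))).
by rewrite -[in LHS]tprojD !tmap_proj pair_mapD tprojD.
Qed.

Lemma tmap_mulr e b : tmap (e * tens 1 b) = tmap e * tens 1 b.
Proof.
elim/tensor_ind: e => [e e' IH IH'|a b']; first by rewrite mulrDl !tmapD IH IH' mulrDl.
by rewrite tensM !tmap_tens tensM !mulr1.
Qed.

Lemma tmap_gen0 c : (forall a, T (a * c) = 0) ->
  forall e, tmap (e * tens c 1) = 0.
Proof.
move=> Tc; elim/tensor_ind => [e e' IH IH'|a b].
  by rewrite mulrDl tmapD IH IH' addr0.
by rewrite tens_mul1r tmap_tens Tc tens0l.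
Qed.

End TensorElements.

Section TensorOperators.
Variables (k : comNzRingType) (A B : algType k).
Local Notation E := (tensor A B).
Variables F G H : {linear A -> A}.

Lemma tmap_gen1 c d : (forall a, F (a * c) = a - G a * d) ->
  forall e : E, tmap F (e * tens c 1) = e - tmap G e * tens d 1.
Proof.
move=> Fc; elim/tensor_ind => [e e' IH IH'|a b].
  by rewrite mulrDl !tmapD IH IH' mulrDl opprD addrACA.
by rewrite !tens_mul1r !tmap_tens Fc tensDl tensNl tens_mul1r.
Qed.

(** This is [(a |-> G a + H a * c) (x) id]; the instance [G = qY], [H = qT], [c = z] will be the
    operator [cW] of the contraction. *)
Definition tmap_comb (c : A) (e : E) : E := tmap G e + tmap H e * tens c 1.

Lemma tmap_combD c : {morph tmap_comb c : e e' / e + e'}.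
Proof. by move=> e e'; rewrite /tmap_comb !tmapD mulrDl addrACA. Qed.

Lemma tmap_comb_tens c a b : tmap_comb c (tens a b) = tens (G a + H a * c) b.
Proof. by rewrite /tmap_comb !tmap_tens tens_mul1r tensDl. Qed.

Lemma tmap_comb_mulr c e b : tmap_comb c (e * tens 1 b) = tmap_comb c e * tens 1 b.
Proof.
elim/tensor_ind: e => [e e' IH IH'|a b'].
  by rewrite (mulrDl e) !tmap_combD IH IH' (mulrDl (tmap_comb c e)).
by rewrite tens_mulr1 !tmap_comb_tens tens_mulr1.
Qed.

Lemma tmap_gen_comb c d d' d'' :
  (forall a, F (a * c) = a - (G a + H a * d) * (d' + d'')) ->
  forall e, tmap F (e * tens c 1) = e - tmap_comb d e * (tens d' 1 + tens d'' 1).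
Proof.
move=> Fc; elim/tensor_ind => [e e' IH IH'|a b].
  by rewrite (mulrDl e) tmapD tmap_combD IH IH' (mulrDl (tmap_comb d e)) opprD addrACA.
by rewrite tens_mul1r tmap_tens Fc tmap_comb_tens tensDl tensNl -tensDl tens_mul1r.
Qed.

Lemma tmap_comb_gen c d' d'' :
  (forall a, G (a * (d' + d'')) + H (a * (d' + d'')) * c = a) ->
  forall e, tmap_comb c (e * (tens d' 1 + tens d'' 1)) = e.
Proof.
move=> GHc; rewrite -tensDl; elim/tensor_ind => [e e' IH IH'|a b].
  by rewrite (mulrDl e) tmap_combD IH IH'.
by rewrite tens_mul1r tmap_comb_tens GHc.
Qed.

End TensorOperators.

(* Automation for noncommutative ring identities, and rules for linear combinations *)
From Stdlib Require Import Ncring Ncring_tac.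
Local Open Scope ring_scope.

#[local] Instance pz_ring_ops (R : pzRingType) :
  @Ring_ops R 0 1 +%R *%R (fun x y => x - y) -%R eq := {}.
#[local] Instance pz_ring (R : pzRingType) : Ring (Ro := pz_ring_ops R).
Proof.
split; first exact: eq_equivalence; try by repeat move=> ? ? ->.
- exact: add0r.
- exact: addrC.
- exact: addrA.
- exact: mul1r.
- exact: mulr1.
- exact: mulrA.
- exact: mulrDl.
- by move=> *; apply: mulrDr.
exact: subrr.
Qed.

Section LinearCombinations.
Variables (k : comNzRingType) (A : algType k) (c : k).
Implicit Types a b d : A.

Lemma lcombN a b : - (c *: a + b) = c *: (- a) - b.
Proof. by rewrite opprD scalerN. Qed.

Lemma lcombD a b a' b' : c *: a + b + (c *: a' + b') = c *: (a + a') + (b + b').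
Proof. by rewrite scalerDr addrACA. Qed.

Lemma lcombMl a b d : (c *: a + b) * d = c *: (a * d) + b * d.
Proof. by rewrite mulrDl scalerAl. Qed.

Lemma lcombMr a b d : d * (c *: a + b) = c *: (d * a) + d * b.
Proof. by rewrite mulrDr scalerAr. Qed.

Definition lcombE := (lcombN, lcombD, lcombMl, lcombMr).

End LinearCombinations.

(** * Automata computing quotients by last and by first letters *)

Section Quotients.
Variable k : fieldType.
Local Notation A := (algA k).

Definition genx : A := genA k (@Ordinal 3 0 isT).
Definition geny : A := genA k (@Ordinal 3 1 isT).
Definition genz : A := genA k (@Ordinal 3 2 isT).
Local Notation x := genx.
Local Notation y := geny.
Local Notation z := genz.

Lemma relxx : (x + y) * x = 0.
Proof. by rewrite /x /y -quot_pi_add -projM mulrDl; apply/proj_rel/RelXX. Qed.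

Lemma relxz : x * z = 0.
Proof. by rewrite -[LHS]projM; apply/proj_rel/RelXZ. Qed.

Lemma relzy : z * y = 0.
Proof. by rewrite -[LHS]projM; apply/proj_rel/RelZY. Qed.

Local Notation state_type := (A * A * A * A * A)%type.

(** The first entry is the element read so far, the others are coefficients. The entry [T] remembers
    [Z] for one step: on [x^2 + yx], the term [T * z] in the rule for [x] cancels the correction
    [Z * z] made by the rule for [y]. *)
Definition rstep (i : 'I_3) (s : state_type) : state_type :=
  let: (a, X, Y, Z, T) := s in
  match val i with
  | 0 => (a * x, a - (Y + T * z) * (x + y), 0, 0, Z)
  | 1 => (a * y, 0, a - Z * z, 0, 0)
  | _ => (a * z, 0, 0, a - X * x, 0)
  end.

Lemma rstep_linear i : linear (rstep i).
Proof.
case: i => [[|[|[|?]]] ?] // c [[[[a X] Y] Z] T] [[[[a' X'] Y'] Z'] T'].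
all: do 4?[apply: injective_projections => /=].
all: by rewrite ?scaler0 ?addr0 // !lcombE.
Qed.

(** The entry [G] remembers the previous [F] up to sign. On [zy], the correction [x * F] in the rule
    for [y] leaves [y * x * F]; the term [x * (x * G)] turns it into [(x + y) * x * F], which is
    zero. *)
Definition lstep (i : 'I_3) (s : state_type) : state_type :=
  let: (a, F, Y, Z, G) := s in
  match val i with
  | 0 => (x * a, a - z * Z, 0, 0, F)
  | 1 => (y * a, - (x * F), a - x * F, 0, - F)
  | _ => (z * a, 0, 0, a - y * Y - x * (x * G), 0)
  end.

Lemma lstep_linear i : linear (lstep i).
Proof.
case: i => [[|[|[|?]]] ?] // c [[[[a X] Y] Z] T] [[[[a' X'] Y'] Z'] T'].
all: do 4?[apply: injective_projections => /=].
all: by rewrite ?scaler0 ?addr0 // !lcombE.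
Qed.

Lemma pair0E (U V : zmodType) (p : U * V) : p.1 = 0 -> p.2 = 0 -> p = 0.
Proof. by case: p => u v /= -> ->. Qed.

(** [free_act_rel] leaves one identity per relation and entry of the state, each of which reduces to
    a multiple of a relation. *)
Lemma rstep_rel r s : relA r ->
  free_act false (fun i => linear_of (rstep_linear i)) r s = 0.
Proof.
apply: free_act_rel => {r} {}s; case: s => [[[[a X] Y] Z] T].
all: do 4?[apply: pair0E => /=].
all: rewrite ?addr0 //.
- transitivity (a * ((x + y) * x)); first by non_commutative_ring.
  by rewrite relxx mulr0.
- by non_commutative_ring.
- by rewrite -mulrA relxz mulr0.
- transitivity ((Y + T * z) * ((x + y) * x)); first by non_commutative_ring.
  by rewrite relxx mulr0.
- by rewrite -mulrA relzy mulr0.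
- transitivity (X * (x * z)); first by non_commutative_ring.
  by rewrite relxz mulr0.
Qed.

Lemma lstep_rel r s : relA r ->
  free_act true (fun i => linear_of (lstep_linear i)) r s = 0.
Proof.
apply: free_act_rel => {r} {}s; case: s => [[[[a X] Y] Z] T].
all: do 4?[apply: pair0E => /=].
all: rewrite ?addr0 //.
- transitivity ((x + y) * x * a); first by non_commutative_ring.
  by rewrite relxx mul0r.
- transitivity (x * z * Z); first by non_commutative_ring.
  by rewrite relxz mul0r.
- transitivity (x * z * Z); first by non_commutative_ring.
  by rewrite relxz mul0r.
- by rewrite subrr.
- by rewrite mulrA relxz mul0r.
- transitivity (z * y * (Y - x * T) + z * ((x + y) * x) * T).
    by non_commutative_ring.
  by rewrite relzy relxx mulr0 !mul0r addr0.
- by rewrite mulrA relzy mul0r.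
- transitivity ((x + y) * x * X); first by non_commutative_ring.
  by rewrite relxx mul0r.
Qed.

Definition rstate : A -> state_type := state rstep_rel (1, 0, 0, 0, 0).

Lemma rstate_linear : linear rstate.
Proof. exact: linearP. Qed.

Definition lstate : A -> state_type := state lstep_rel (1, 0, 0, 0, 0).

Lemma lstate_linear : linear lstate.
Proof. exact: linearP. Qed.

Lemma rstate1 : rstate 1 = (1, 0, 0, 0, 0).
Proof. exact: (state1 rstep_rel). Qed.

Lemma rstate_gen i a : rstate (a * genA k i) = rstep i (rstate a).
Proof. exact: (state_gen rstep_rel). Qed.

Lemma lstate1 : lstate 1 = (1, 0, 0, 0, 0).
Proof. exact: (state1 lstep_rel). Qed.

Lemma lstate_gen i a : lstate (genA k i * a) = lstep i (lstate a).
Proof. exact: (state_gen lstep_rel). Qed.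

Lemma rstate_id a : (rstate a).1.1.1.1 = a.
Proof.
elim/algA_rind: a => [c a b IHa IHb||a i IH].
- by rewrite rstate_linear /= IHa IHb.
- by rewrite rstate1.
rewrite rstate_gen -[in RHS]IH; case: (rstate a) => [[[[a' X] Y] Z] T] /=.
by case: i => [[|[|[|?]]] ?] //=; congr (_ * genA k _); apply: val_inj.
Qed.

Lemma lstate_id a : (lstate a).1.1.1.1 = a.
Proof.
elim/algA_lind: a => [c a b IHa IHb||a i IH].
- by rewrite lstate_linear /= IHa IHb.
- by rewrite lstate1.
rewrite lstate_gen -[in RHS]IH; case: (lstate a) => [[[[a' X] Y] Z] T] /=.
by case: i => [[|[|[|?]]] ?] //=; congr (genA k _ * _); apply: val_inj.
Qed.

(* [qX a], [qY a], [qZ a] are coefficients of the last letters [x], [y], [z] of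
   [a], and [qT a] is the coefficient of the last two letters [zx]. They are
   defined by the transition rules of the automaton, which are compatible with
   the relations of [A]. *)
Record right_quotients := RightQuotients {
  qX : {linear A -> A};
  qY : {linear A -> A};
  qZ : {linear A -> A};
  qT : {linear A -> A};
  qX1 : qX 1 = 0;
  qY1 : qY 1 = 0;
  qZ1 : qZ 1 = 0;
  qT1 : qT 1 = 0;
  qXx : forall a, qX (a * x) = a - (qY a + qT a * z) * (x + y);
  qXy : forall a, qX (a * y) = 0;
  qXz : forall a, qX (a * z) = 0;
  qYx : forall a, qY (a * x) = 0;
  qYy : forall a, qY (a * y) = a - qZ a * z;
  qYz : forall a, qY (a * z) = 0;
  qZx : forall a, qZ (a * x) = 0;
  qZy : forall a, qZ (a * y) = 0;
  qZz : forall a, qZ (a * z) = a - qX a * x;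
  qTx : forall a, qT (a * x) = qZ a;
  qTy : forall a, qT (a * y) = 0;
  qTz : forall a, qT (a * z) = 0
}.

(** The operators are the entries of the state reached by the automaton; the record retains only its
    transition rules. *)
Lemma right_quotients_exist : inhabited right_quotients.
Proof.
have Xl : linear (fun a => (rstate a).1.1.1.2) by move=> c a b; rewrite rstate_linear.
have Yl : linear (fun a => (rstate a).1.1.2) by move=> c a b; rewrite rstate_linear.
have Zl : linear (fun a => (rstate a).1.2) by move=> c a b; rewrite rstate_linear.
have Tl : linear (fun a => (rstate a).2) by move=> c a b; rewrite rstate_linear.
split; apply: (@RightQuotients (linear_of Xl) (linear_of Yl) (linear_of Zl)
  (linear_of Tl)).
1-4: by rewrite /= rstate1.
all: move=> a; rewrite /= rstate_gen.
all: case: (rstate a) (rstate_id a) => [[[[a' X] Y] Z] T] /= E.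
all: by rewrite ?E ?add0r ?mul0r ?subr0 ?addr0.
Qed.

(* The mirror image: [pF a], [pY a], [pZ a] are coefficients of the first letters
   [x], [y], [z] of [a]; [pG] makes the rules compatible with the relations. *)
Record left_quotients := LeftQuotients {
  pF : {linear A -> A};
  pY : {linear A -> A};
  pZ : {linear A -> A};
  pG : {linear A -> A};
  pF1 : pF 1 = 0;
  pFx : forall a, pF (x * a) = a - z * pZ a;
  pFy : forall a, pF (y * a) = - (x * pF a);
  pFz : forall a, pF (z * a) = 0;
  pYx : forall a, pY (x * a) = 0;
  pYy : forall a, pY (y * a) = a - x * pF a;
  pYz : forall a, pY (z * a) = 0;
  pZx : forall a, pZ (x * a) = 0;
  pZy : forall a, pZ (y * a) = 0;
  pZz : forall a, pZ (z * a) = a - y * pY a - x * (x * pG a)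
}.

Lemma left_quotients_exist : inhabited left_quotients.
Proof.
have Xl : linear (fun a => (lstate a).1.1.1.2) by move=> c a b; rewrite lstate_linear.
have Yl : linear (fun a => (lstate a).1.1.2) by move=> c a b; rewrite lstate_linear.
have Zl : linear (fun a => (lstate a).1.2) by move=> c a b; rewrite lstate_linear.
have Tl : linear (fun a => (lstate a).2) by move=> c a b; rewrite lstate_linear.
split; apply: (@LeftQuotients (linear_of Xl) (linear_of Yl) (linear_of Zl)
  (linear_of Tl)).
1: by rewrite /= lstate1.
all: move=> a; rewrite /= lstate_gen.
all: case: (lstate a) (lstate_id a) => [[[[a' X] Y] Z] T] /= E.
all: by rewrite ?E ?add0r ?mul0r ?subr0 ?addr0.
Qed.

End Quotients.

(** * The Koszul complex and its exactness in positive degrees *)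

Local Notation ix := (@Ordinal 3 0 isT).
Local Notation iy := (@Ordinal 3 1 isT).
Local Notation iz := (@Ordinal 3 2 isT).

(* Models [E = A (x) A^op] with [cl g = g (x) 1] and [cr g = 1 (x) g]; products of
   the [cr g] are thus reversed. The operators [cX], [cY], [cZ], [cW] act on the
   left tensor factor, which [cfil] filters by degree. *)
Record contraction (E : pzRingType) := Contraction {
  cl : 'I_3 -> E;
  cr : 'I_3 -> E;
  lrC : forall i j, cr j * cl i = cl i * cr j;
  lxx : (cl ix + cl iy) * cl ix = 0;
  lxz : cl ix * cl iz = 0;
  lzy : cl iz * cl iy = 0;
  rxx : cr ix * (cr ix + cr iy) = 0;
  rzx : cr iz * cr ix = 0;
  ryz : cr iy * cr iz = 0;
  cX : E -> E;
  cY : E -> E;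
  cZ : E -> E;
  cW : E -> E;
  cXD : {morph cX : u v / u + v};
  cYD : {morph cY : u v / u + v};
  cZD : {morph cZ : u v / u + v};
  cWD : {morph cW : u v / u + v};
  cXr : forall u j, cX (u * cr j) = cX u * cr j;
  cYr : forall u j, cY (u * cr j) = cY u * cr j;
  cZr : forall u j, cZ (u * cr j) = cZ u * cr j;
  cWr : forall u j, cW (u * cr j) = cW u * cr j;
  cXx : forall u, cX (u * cl ix) = u - cW u * (cl ix + cl iy);
  cXy : forall u, cX (u * cl iy) = 0;
  cXz : forall u, cX (u * cl iz) = 0;
  cYx : forall u, cY (u * cl ix) = 0;
  cYy : forall u, cY (u * cl iy) = u - cZ u * cl iz;
  cYz : forall u, cY (u * cl iz) = 0;
  cZx : forall u, cZ (u * cl ix) = 0;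
  cZy : forall u, cZ (u * cl iy) = 0;
  cZz : forall u, cZ (u * cl iz) = u - cX u * cl ix;
  cWxy : forall u, cW (u * (cl ix + cl iy)) = u;
  cfil : nat -> E -> Prop;
  cfil0 : forall u, cfil 0 u -> u = 0;
  cfilD : forall n u v, cfil n u -> cfil n v -> cfil n (u + v);
  cfilN : forall n u, cfil n u -> cfil n (- u);
  cfilr : forall n u j, cfil n u -> cfil n (u * cr j);
  cfilX : forall n u, cfil n.+1 u -> cfil n (cX u);
  cfilY : forall n u, cfil n.+1 u -> cfil n (cY u);
  cfilZ : forall n u, cfil n.+1 u -> cfil n (cZ u);
  cfilW : forall n u, cfil n.+1 u -> cfil n (cW u);
  cfil_le : forall (m n : nat) u, leq m n -> cfil m u -> cfil n u;
  cfil_ex : forall u, exists n : nat, cfil n u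
}.

Section KoszulComplex.
Variables (E : pzRingType) (C : contraction E).
Local Notation lx := (cl C ix).
Local Notation ly := (cl C iy).
Local Notation lz := (cl C iz).
Local Notation rx := (cr C ix).
Local Notation ry := (cr C iy).
Local Notation rz := (cr C iz).
Local Notation X := (cX C).
Local Notation Y := (cY C).
Local Notation Z := (cZ C).
Local Notation W := (cW C).
Local Notation fil := (cfil C).

(** Koszul differentials: a basis word of degree [n], with [x + y] counted as one letter, gives up
    its first letter to the left factor and, with sign [(-1)^n], its last letter to the right
    factor. Coordinates are ordered as [x, y, z] in degree 1, [(x + y)x, xz, zy] in degree 2 and
    [xzy, (x + y)xz] in degree 3. *)
Definition D1 (s : E * E * E) : E :=
  let: (u, v, w) := s in u * (lx - rx) + v * (ly - ry) + w * (lz - rz).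

Definition D2 (s : E * E * E) : E * E * E :=
  let: (p, q, s) := s in
  (p * (lx + ly + rx) + q * rz, p * rx + s * lz, q * lx + s * ry).

Definition D3 (s : E * E) : E * E * E :=
  let: (a, b) := s in (- (b * rz), b * (lx + ly) - a * ry, a * lx).

Definition D4 (c : E) : E * E := (c * (lx + ly), c * ry).

Lemma morph_add0 (f : E -> E) : {morph f : u v / u + v} -> f 0 = 0.
Proof. by move=> fD; apply: (addIr (f 0)); rewrite -fD !add0r. Qed.

Lemma D12 s : D1 (D2 s) = 0.
Proof.
case: s => [[p q] s]; rewrite /D1 /D2.
(* Every term is grouped into a multiple of a relation or of a commutator between a left and a right
   letter. *)
transitivity (p * ((lx + ly) * lx) - p * (rx * (rx + ry)) + p * (rx * lx - lx * rx)
  + p * (rx * ly - ly * rx) + q * (rz * lx - lx * rz) + q * (lx * lz)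
  - q * (rz * rx) + s * (ry * lz - lz * ry) + s * (lz * ly) - s * (ry * rz)).
  by non_commutative_ring.
by rewrite lxx rxx lxz lzy rzx ryz !lrC !subrr !mulr0 !(subr0, addr0).
Qed.

Lemma D23 s : D2 (D3 s) = 0.
Proof.
case: s => a b; rewrite /D2 /D3; apply: pair0E; first apply: pair0E => /=.
- transitivity (b * (lx * rz - rz * lx) + b * (ly * rz - rz * ly)
    - b * (rz * rx) - a * (ry * rz)); first by non_commutative_ring.
  by rewrite ryz rzx !lrC !subrr !mulr0 !(subr0, addr0).
- transitivity (a * (lx * lz) - b * (rz * rx)); first by non_commutative_ring.
  by rewrite lxz rzx !mulr0 subrr.
rewrite /=; transitivity (b * ((lx + ly) * lx) + a * (lx * ry - ry * lx)).
  by non_commutative_ring.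
by rewrite lxx lrC subrr !mulr0 addr0.
Qed.

Lemma D34 c : D3 (D4 c) = 0.
Proof.
rewrite /D3 /D4; apply: pair0E; first apply: pair0E => /=.
- by rewrite -mulrA ryz mulr0 oppr0.
- transitivity (c * (ry * lx - lx * ry) + c * (ry * ly - ly * ry)).
    by non_commutative_ring.
  by rewrite !lrC !subrr !mulr0 addr0.
by rewrite /= -mulrA lxx mulr0.
Qed.

(** [W] undoes right multiplication by [lx + ly]. *)
Lemma D4_inj c : D4 c = 0 -> c = 0.
Proof.
by move=> [/(congr1 W)]; rewrite cWxy (morph_add0 (cWD C)).
Qed.

(** Applying [X] to [a * lx = 0] gives [a = W a * (lx + ly)]. The middle equation then becomes
    [(b - W a * ry) * (lx + ly) = 0], and [W] cancels the last factor. *)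
Lemma D3_exact s : D3 s = 0 -> exists c, D4 c = s.
Proof.
case: s => a b [_ b0 a0].
have aE : a = W a * (lx + ly).
  by apply/eqP; rewrite -subr_eq0 -cXx a0 (morph_add0 (cXD C)).
exists (W a); rewrite /D4 -aE; congr pair.
have : (b - W a * ry) * (lx + ly) = 0.
  transitivity (b * (lx + ly) - W a * (lx + ly) * ry
    + W a * (lx * ry - ry * lx) + W a * (ly * ry - ry * ly)).
    by non_commutative_ring.
  by rewrite -aE !lrC !subrr !mulr0 !addr0.
move=> /(congr1 W); rewrite cWxy (morph_add0 (cWD C)) => /eqP.
by rewrite subr_eq0 => /eqP.
Qed.

(* The right-hand side has lower degree than [u]. *)
Lemma W_descent u : u = - (W u * rx) -> u = 0.
Proof.
have [n] := cfil_ex C u; elim: n u => [|n IH] u fu uE; first exact: cfil0 fu.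
by apply: IH (uE); rewrite uE; apply/cfilN/cfilr/cfilW.
Qed.

Lemma D2_exact s : D2 s = 0 -> exists t, D3 t = s.
Proof.
case: s => [[p q] s] [e1 e2 e3].
have qE : q = W q * (lx + ly) - X s * ry.
  move/(congr1 X): e3; rewrite cXD cXr cXx (morph_add0 (cXD C)) => e3.
  rewrite -[LHS](subr0 q) -[in LHS]e3; non_commutative_ring.
(* By [qE], subtracting [D3 (X s, W q)] from [(p, q, s)] leaves [(p', 0, s')]. *)
pose p' := p + W q * rz; pose s' := s - X s * lx.
have p'0 : p' = 0.
  apply: W_descent.
  have : p' * (lx + ly + rx) = 0.
    transitivity (p * (lx + ly + rx) + q * rz - (q - (W q * (lx + ly) - X s * ry)) * rz
      + W q * (rz * lx - lx * rz) + W q * (rz * ly - ly * rz) + W q * (rz * rx)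
      + X s * (ry * rz)).
      by rewrite /p'; non_commutative_ring.
    by rewrite e1 -qE rzx ryz !lrC !subrr !mulr0 mul0r !addr0 subr0.
  move/(congr1 W); rewrite mulrDr cWD cWxy cWr (morph_add0 (cWD C)).
  by move/eqP; rewrite addr_eq0 => /eqP.
have pE : p = - (W q * rz) by apply/eqP; rewrite -addr_eq0 -p'0.
have s'z : s' * lz = 0.
  transitivity (p * rx + s * lz - (p + W q * rz) * rx + W q * (rz * rx)
    - X s * (lx * lz)); first by rewrite /s'; non_commutative_ring.
  by rewrite e2 -/p' p'0 rzx lxz !mulr0 mul0r !subr0 addr0.
have s'y : s' * ry = 0.
  transitivity (q * lx + s * ry - (q - (W q * (lx + ly) - X s * ry)) * lx
    - W q * ((lx + ly) * lx) + X s * (ry * lx - lx * ry)).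
    by rewrite /s'; non_commutative_ring.
  by rewrite e3 -qE lxx !lrC !subrr !mulr0 mul0r !subr0 addr0.
have s'E : s' = X s' * lx.
  by apply/eqP; rewrite -subr_eq0 -cZz s'z (morph_add0 (cZD C)).
have Xs'y : X s' * ry = 0 by rewrite -cXr s'y (morph_add0 (cXD C)).
(* The remainder is [(0, 0, s')], which is [D3 (X s', 0)] because [X s' * lx = s'] and
   [X s' * ry = 0]. *)
exists (X s + X s', W q); rewrite /D3; congr (_, _, _).
- by rewrite pE.
- by rewrite mulrDl Xs'y addr0 -qE.
by rewrite mulrDl -s'E /s' addrC subrK.
Qed.

Lemma lcomb1 (c u u' g : E) : (c * u + u') * g = c * (u * g) + u' * g.
Proof. by non_commutative_ring. Qed.

Lemma lcombN1 (c u u' g : E) : - ((c * u + u') * g) = c * - (u * g) - u' * g.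
Proof. by non_commutative_ring. Qed.

Lemma lcomb2 (c u u' v v' g h : E) : (c * u + u') * g + (c * v + v') * h =
  c * (u * g + v * h) + (u' * g + v' * h).
Proof. by non_commutative_ring. Qed.

Lemma lcombB2 (c u u' v v' g h : E) : (c * u + u') * g - (c * v + v') * h =
  c * (u * g - v * h) + (u' * g - v' * h).
Proof. by non_commutative_ring. Qed.

Lemma lcomb3 (c u u' v v' w w' g h i : E) :
  (c * u + u') * g + (c * v + v') * h + (c * w + w') * i =
  c * (u * g + v * h + w * i) + (u' * g + v' * h + w' * i).
Proof. by non_commutative_ring. Qed.

Lemma D1_linear : linear (D1 : E^o * E^o * E^o -> E^o).
Proof. by move=> c [[u v] w] [[u' v'] w']; apply: lcomb3. Qed.

Lemma D2_linear : linear (D2 : E^o * E^o * E^o -> E^o * E^o * E^o).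
Proof.
move=> c [[u v] w] [[u' v'] w'].
by apply: injective_projections; first apply: injective_projections;
  apply: lcomb2.
Qed.

Lemma D3_linear : linear (D3 : E^o * E^o -> E^o * E^o * E^o).
Proof.
move=> c [u v] [u' v'].
apply: injective_projections; first apply: injective_projections.
- exact: lcombN1.
- exact: lcombB2.
exact: lcomb1.
Qed.

Lemma D4_linear : linear (D4 : E^o -> E^o * E^o).
Proof.
by move=> c u u'; apply: injective_projections; apply: lcomb1.
Qed.

Lemma D1D s t : D1 (s + t) = D1 s + D1 t.
Proof. by have := D1_linear 1 s t; rewrite !scale1r. Qed.

Lemma D2D s t : D2 (s + t) = D2 s + D2 t.
Proof. by have := D2_linear 1 s t; rewrite !scale1r. Qed.

(** Induction on a common degree bound for the three coordinates: modulo a boundary, a left letter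
    can be exchanged for a right one, which lowers the degree in the left factor. *)
Lemma D1_exact s : D1 s = 0 -> exists t, D2 t = s.
Proof.
case: s => [[u v] w].
have [n [fu fv fw]] : exists n, [/\ fil n u, fil n v & fil n w].
  have [n1 f1] := cfil_ex C u; have [n2 f2] := cfil_ex C v.
  have [n3 f3] := cfil_ex C w; exists (maxn n1 (maxn n2 n3)).
  by split; [apply: cfil_le f1 | apply: cfil_le f2 | apply: cfil_le f3];
    rewrite !leq_max leqnn ?orbT.
elim: n u v w fu fv fw => [|n IH] u v w fu fv fw e.
  exists 0; rewrite (cfil0 fu) (cfil0 fv) (cfil0 fw) /D2 /=.
  by rewrite !mul0r !addr0.
(* An additive operator commuting with the right letters may be applied to [D1 s = 0] after the left
   and right terms are separated. *)
have op_e (f : E -> E) : {morph f : a b / a + b} ->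
    (forall a j, f (a * cr C j) = f a * cr C j) ->
    f (u * lx) + f (v * ly) + f (w * lz) = f u * rx + f v * ry + f w * rz.
  move=> fD fr; rewrite -!fr -!fD; congr f; apply/eqP; rewrite -subr_eq0; apply/eqP.
  by rewrite -e /D1; non_commutative_ring.
(* [(u', v', w')] is [(u, v, w) - D2 (W u, X w, Z v)], of lower degree. *)
pose u' := X u * rx + X v * ry - W u * rx.
pose v' := Y u * rx + Y v * ry + Y w * rz - W u * rx.
pose w' := Z u * rx + Z w * rz.
have sE : (u, v, w) = (u', v', w') + D2 (W u, X w, Z v).
  have := op_e _ (cXD C) (cXr C); rewrite cXx cXy cXz !addr0 => eX.
  have := op_e _ (cYD C) (cYr C); rewrite cYx cYy cYz add0r addr0 => eY.
  have := op_e _ (cZD C) (cZr C); rewrite cZx cZy cZz !add0r => eZ.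
  rewrite /D2; congr (_, _, _).
  - rewrite /= -[LHS](subrK (W u * (lx + ly))) eX /u'; non_commutative_ring.
  - rewrite /= -[LHS](subrK (Z v * lz)) eY /v'; non_commutative_ring.
  by rewrite /= -[LHS](subrK (X w * lx)) eZ /w'; non_commutative_ring.
have [||||t tE] := IH u' v' w'.
- apply: cfilD; [apply: cfilD|apply: cfilN]; apply: cfilr.
  + exact: cfilX.
  + exact: cfilX.
  exact: cfilW.
- apply: cfilD; [apply: cfilD; [apply: cfilD|]|apply: cfilN]; apply: cfilr;
    by [apply: cfilY | apply: cfilW].
- by apply: cfilD; apply: cfilr; apply: cfilZ.
- by move: e; rewrite sE D1D D12 addr0.
by exists (t + (W u, X w, Z v)); rewrite D2D tE -sE.
Qed.

End KoszulComplex.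

(** * The contraction operators on the enveloping algebra *)

Section Contraction.
Variables (k : fieldType) (Q : right_quotients k).
Local Notation A := (algA k).
Local Notation E := (tensor A A^c).
Local Notation gen := (genA k).
Local Notation X := (qX Q).
Local Notation Y := (qY Q).
Local Notation Z := (qZ Q).
Local Notation T := (qT Q).
Local Notation x := (genx k).
Local Notation y := (geny k).
Local Notation z := (genz k).

(** Stage [n] is spanned by words of length strictly less than [n]; with this shift stage 0 is zero,
    where the descents end. *)
Inductive wfil : nat -> A -> Prop :=
| wfil_zero n : wfil n 0
| wfilP n c a b : wfil n a -> wfil n b -> wfil n (c *: a + b)
| wfil1 n : wfil n.+1 1
| wfilM n a i : wfil n a -> wfil n.+1 (a * gen i).

Lemma wfilD n a b : wfil n a -> wfil n b -> wfil n (a + b).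
Proof. by move=> fa fb; rewrite -[a]scale1r; apply: wfilP. Qed.

Lemma wfilN n a : wfil n a -> wfil n (- a).
Proof.
by move=> fa; rewrite -scaleN1r -[_ *: _]addr0; apply: wfilP => //; apply: wfil_zero.
Qed.

Lemma wfil0_eq a : wfil 0 a -> a = 0.
Proof.
suff fil_eq0 n : wfil n a -> n = O -> a = 0 by move=> /fil_eq0; apply.
elim=> {n a} // n c a b _ IHa _ IHb n0.
by rewrite (IHa n0) (IHb n0) scaler0 addr0.
Qed.

Lemma wfil_le m n a : leq m n -> wfil m a -> wfil n a.
Proof.
move=> mn fa; elim: fa n mn => {m a} [m|m c a b _ IHa _ IHb|m|m a i _ IH] n mn.
- exact: wfil_zero.
- by apply: wfilP; [apply: IHa | apply: IHb].
- by case: n mn => // n _; apply: wfil1.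
by case: n mn => // n mn; apply: wfilM; apply: IH.
Qed.

Lemma wfil_ex a : exists n, wfil n a.
Proof.
elim/algA_rind: a => [c a b [m fa] [n fb]||a i [n fa]].
- exists (maxn m n); apply: wfilP; first by apply: wfil_le fa; apply: leq_maxl.
  by apply: wfil_le fb; apply: leq_maxr.
- by exists (S O); apply: wfil1.
by exists n.+1; apply: wfilM.
Qed.

(** Removing a letter lowers the degree, and the correction terms restore exactly what they removed.
    [T] is bounded in the form [T a * z], in which it enters [W]. *)
Lemma wfil_quotients n a : wfil n a ->
  [/\ wfil n.-1 (X a), wfil n.-1 (Y a), wfil n.-1 (Z a) & wfil n.-1 (T a * z)].
Proof.
have z0 m : [/\ wfil m (X 0), wfil m (Y 0), wfil m (Z 0) & wfil m (T 0 * z)].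
  by rewrite !linear0 mul0r; split; apply: wfil_zero.
elim=> [m|m c a1 a2 _ [Xa Ya Za Ta] _ [Xb Yb Zb Tb]|m|{n}n {}a i fa].
- exact: z0.
- rewrite !linearP lcombMl; split; exact: wfilP.
- by rewrite qX1 qY1 qZ1 qT1 mul0r; split; apply: wfil_zero.
(* At [n = 0] the truncated predecessor makes the induction hypothesis too weak, but there
   [a = 0]. *)
case: n fa => [/wfil0_eq-> _|n fa [Xa Ya Za Ta]]; first by rewrite mul0r; apply: z0.
have fW : wfil n.+1 ((Y a + T a * z) * (x + y)).
  by rewrite mulrDr; apply: wfilD; apply: wfilM; apply: wfilD.
case: i => [[|[|[|?]]] ?] //=.
- rewrite (_ : gen _ = x); last by congr (genA k _); apply: val_inj.
  rewrite qXx qYx qZx qTx; split; try exact: wfil_zero; last exact: wfilM.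
  by apply: wfilD; last apply: wfilN.
- rewrite (_ : gen _ = y); last by congr (genA k _); apply: val_inj.
  rewrite qXy qYy qZy qTy mul0r; split; try exact: wfil_zero.
  by apply: wfilD; last apply/wfilN/wfilM.
rewrite (_ : gen _ = z); last by congr (genA k _); apply: val_inj.
rewrite qXz qYz qZz qTz mul0r; split; try exact: wfil_zero.
by apply: wfilD; last apply/wfilN/wfilM.
Qed.

Inductive efil (n : nat) : E -> Prop :=
| efil_zero : efil n 0
| efilD u v : efil n u -> efil n v -> efil n (u + v)
| efil_tens a b : wfil n a -> efil n (tens a b).

Definition lE i : E := tens (gen i) 1.
Definition rE j : E := tens 1 (gen j : A^c).

Definition tW : E -> E := tmap_comb Y T z.

Lemma efil0_eq u : efil 0 u -> u = 0.
Proof.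
elim=> [//|v w _ -> _ ->|a b /wfil0_eq->]; first by rewrite addr0.
exact: tens0l.
Qed.

Lemma efilN n u : efil n u -> efil n (- u).
Proof.
elim=> [|v w _ IHv _ IHw|a b fa].
- by rewrite oppr0; apply: efil_zero.
- by rewrite opprD; apply: efilD.
by rewrite -tensNl; apply: efil_tens; apply: wfilN.
Qed.

Lemma efilr n u j : efil n u -> efil n (u * rE j).
Proof.
elim=> [|v w _ IHv _ IHw|a b fa].
- by rewrite mul0r; apply: efil_zero.
- by rewrite mulrDl; apply: efilD.
by rewrite tens_mulr1; apply: efil_tens.
Qed.

Lemma efil_le (m n : nat) u : leq m n -> efil m u -> efil n u.
Proof.
move=> mn; elim=> [|v w _ IHv _ IHw|a b fa].
- exact: efil_zero.
- exact: efilD.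
by apply: efil_tens; apply: wfil_le fa.
Qed.

Lemma efil_ex u : exists n, efil n u.
Proof.
elim/tensor_ind: u => [u v [m fu] [n fv]|a b].
  exists (maxn m n); apply: efilD; first by apply: efil_le fu; apply: leq_maxl.
  by apply: efil_le fv; apply: leq_maxr.
by have [n fa] := wfil_ex a; exists n; apply: efil_tens.
Qed.

Lemma efil_op n (f : E -> E) : {morph f : u v / u + v} ->
  (forall a b, wfil n.+1 a -> efil n (f (tens a b))) ->
  forall u, efil n.+1 u -> efil n (f u).
Proof.
move=> fD ft u; elim=> [|v w _ IHv _ IHw|a b fa].
- by rewrite (morph_add0 fD); apply: efil_zero.
- by rewrite fD; apply: efilD.
exact: ft.
Qed.

Lemma efil_tmap n (f : {linear A -> A}) :
  (forall a, wfil n.+1 a -> wfil n (f a)) ->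
  forall u : E, efil n.+1 u -> efil n (tmap f u).
Proof.
move=> ff; apply: efil_op => [u v|a b fa]; first exact: tmapD.
by rewrite tmap_tens; apply: efil_tens; apply: ff.
Qed.

Lemma efilW n u : efil n.+1 u -> efil n (tW u).
Proof.
apply: efil_op => [|a b /wfil_quotients[_ Ya _ Ta]]; first exact: tmap_combD.
by rewrite /tW tmap_comb_tens; apply: efil_tens; apply: wfilD.
Qed.

Lemma tens1_mul0 (a b : A) : b * a = 0 -> tens 1 (a : A^c) * tens 1 (b : A^c) = 0 :> E.
Proof. by move=> ba0; rewrite tens_mul1l [_ * _]ba0 tens0r. Qed.

Lemma tens_mul01 (a b : A) : a * b = 0 -> tens a 1 * tens b 1 = 0 :> E.
Proof. by move=> ab0; rewrite tens_mul1r ab0 tens0l. Qed.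

(** The correction [- Z a * z] in [Y (a * y)] is compensated by [T (a * x) * z = Z a * z]. *)
Lemma qW a : Y (a * (x + y)) + T (a * (x + y)) * z = a.
Proof. by rewrite mulrDr !linearD qYx qYy qTx qTy add0r addr0 subrK. Qed.

(** The values of [cl] and [cr] are recorded because the abstract contraction does not determine how
    the letters act on [A]. *)
Lemma envelope_contraction : exists C : contraction E, cl C = lE /\ cr C = rE.
Proof.
unshelve eexists (@Contraction E lE rE _ _ _ _ _ _ _ (tmap X) (tmap Y) (tmap Z) tW
  (tmapD X) (tmapD Y) (tmapD Z) (tmap_combD _ _ _) (fun u j => tmap_mulr X u _)
  (fun u j => tmap_mulr Y u _) (fun u j => tmap_mulr Z u _)
  (fun u j => tmap_comb_mulr _ _ _ u _)
  _ _ _ _ _ _ _ _ _ _ efil efil0_eq efilD efilN efilr _ _ _ efilW efil_le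
  efil_ex); last by split.
- by move=> i j; apply: tens_comm.
- by rewrite /lE -tensDl; apply: tens_mul01; apply: relxx.
- by apply: tens_mul01; apply: relxz.
- by apply: tens_mul01; apply: relzy.
- by rewrite /rE -tensDr; apply: tens1_mul0; apply: relxx.
- by apply: tens1_mul0; apply: relxz.
- by apply: tens1_mul0; apply: relzy.
- by apply: tmap_gen_comb; apply: qXx.
- by apply: tmap_gen0; apply: qXy.
- by apply: tmap_gen0; apply: qXz.
- by apply: tmap_gen0; apply: qYx.
- by apply: tmap_gen1; apply: qYy.
- by apply: tmap_gen0; apply: qYz.
- by apply: tmap_gen0; apply: qZx.
- by apply: tmap_gen0; apply: qZy.
- by apply: tmap_gen1; apply: qZz.
- by apply: tmap_comb_gen; apply: qW.
- by move=> n; apply: efil_tmap => a /wfil_quotients[].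
- by move=> n; apply: efil_tmap => a /wfil_quotients[].
- by move=> n; apply: efil_tmap => a /wfil_quotients[].
Qed.

End Contraction.

(** * Solving the cocycle equation in degree 3 *)

Section ThirdCohomology.
Variables (k : fieldType) (Q : right_quotients k) (P : left_quotients k).
Local Notation A := (algA k).
Local Notation x := (genx k).
Local Notation y := (geny k).
Local Notation z := (genz k).

(** Stripping first letters from [b * y] preserves the last [y], except when [y] itself is stripped,
    which accounts for the constant [c]. The claims on [pF] and [pZ] carry the induction. The latter
    is multiplied by [z] so that the terms of [pZz] in [pY] and [pG] disappear: [z * y] and
    [z * x * x] are zero. *)
Lemma left_quotients_muly (b : A) : exists d d' d'' (c : k),
  [/\ pY P (b * y) = d * y + c *: 1, pF P (b * y) = d' * y
    & z * pZ P (b * y) = d'' * y].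
Proof.
elim/algA_lind: b => [c a b [d1 [d1' [d1'' [c1 [Ya Fa Za]]]]]
  [d2 [d2' [d2'' [c2 [Yb Fb Zb]]]]]||b i [d [d' [d'' [c [Yb Fb Zb]]]]]].
- exists (c *: d1 + d2), (c *: d1' + d2'), (c *: d1'' + d2''), (c * c1 + c2).
  have lin (f : {linear A -> A}) :
      f ((c *: a + b) * y) = c *: f (a * y) + f (b * y).
    by rewrite -linearP; congr (f _); apply: lcombMl.
  split; rewrite lin.
  - rewrite Ya Yb (lcombMl c d1 d2 y) scalerDr scalerA.
    by rewrite (scalerDl 1 (c * c1)) addrACA.
  - by rewrite Fa Fb (lcombMl c d1' d2' y).
  by rewrite (lcombMr c _ _ z) Za Zb (lcombMl c d1'' d2'' y).
- exists 0, 0, 0, 1; rewrite mul1r !mul0r scale1r add0r.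
  have := (pYy P 1, pFy P 1, pZy P 1); rewrite mulr1 pF1 mulr0 oppr0 addr0.
  by move=> E; rewrite !E mulr0.
rewrite -mulrA; case: i => [[|[|[|?]]] ?] //=.
- rewrite (_ : genA _ _ = x); last by congr (genA k _); apply: val_inj.
  exists 0, (b - d''), 0, 0; split.
  - by rewrite pYx mul0r scale0r addr0.
  - by rewrite pFx Zb mulrBl.
  by rewrite pZx mulr0 mul0r.
- rewrite (_ : genA _ _ = y); last by congr (genA k _); apply: val_inj.
  exists (b - x * d'), (- (x * d')), 0, 0; split.
  - by rewrite pYy Fb scale0r addr0 mulrBl mulrA.
  - by rewrite pFy Fb mulNr mulrA.
  by rewrite pZy mulr0 mul0r.
rewrite (_ : genA _ _ = z); last by congr (genA k _); apply: val_inj.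
exists 0, 0, (z * b), 0; split.
- by rewrite pYz mul0r scale0r addr0.
- by rewrite pFz mul0r.
rewrite pZz; set u := pY P _; set v := pG P _.
transitivity (z * b * y - z * y * u - (z * ((x + y) * x) - z * y * x) * v).
  by non_commutative_ring.
by rewrite relxx relzy mulr0 !mul0r subrr mul0r !subr0.
Qed.

(** Applying [pY] to the equation determines [a] up to the constant [c]. Substituting back gives
    [(b - (x + y) * d) * y = c *: (x + y)]; the last-letter quotients then yield first [c = 0] and
    next the shape of [b]. *)
Lemma cocycle3_coboundary (a b : A) : (x + y) * a + b * y = 0 ->
  exists p q r, a = x * r - q * y /\ b = (x + y) * q - p * z.
Proof.
move=> e; have [d [_ [_ [c [Yb _ _]]]]] := left_quotients_muly b.
have aE : a = x * pF P a - d * y - c *: 1.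
  have : pY P ((x + y) * a) = - pY P (b * y).
    by rewrite -linearN; congr (pY P _); apply/eqP; rewrite -addr_eq0 e.
  rewrite mulrDl linearD pYx pYy add0r Yb => /eqP.
  by rewrite subr_eq addrC opprD addrA => /eqP.
have b'E : (b - (x + y) * d) * y = c *: (x + y).
  have tE : (x + y) * (c *: 1) = c *: (x + y) by rewrite -scalerAr mulr1.
  rewrite -tE; move: (c *: 1) (pF P a) aE => t f aE.
  transitivity ((x + y) * a + b * y + (x + y) * t - (x + y) * x * f).
    by rewrite aE; non_commutative_ring.
  by rewrite e relxx mul0r subr0 add0r.
have xE : qX Q (x + y) = 1.
  have := (qXx Q 1, qXy Q 1).
  by rewrite !mul1r linearD qY1 qT1 mul0r addr0 mul0r subr0 => -[-> ->]; rewrite addr0.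
(* [qX] kills right multiples of [y] but sends [x + y] to 1. *)
have c0 : c *: (1 : A) = 0 by rewrite -xE -linearZ -[RHS](qXy Q (b - (x + y) * d)) b'E.
(* With [c = 0] the product with [y] vanishes, and [qYy] turns this into divisibility by [z] on the
   right. *)
have b'z : b - (x + y) * d = qZ Q (b - (x + y) * d) * z.
  apply/eqP; rewrite -subr_eq0 -qYy b'E -[x + y]mulr1 scalerAr c0 mulr0.
  by rewrite linear0.
exists (- qZ Q (b - (x + y) * d)), d, (pF P a); split.
  by rewrite {1}aE c0 subr0.
by rewrite mulNr opprK -b'z addrC subrK.
Qed.

End ThirdCohomology.

(** * Maps out of free modules and the Koszul resolution of [A] *)

Lemma mulr_split (R : pzRingType) (e g h : R) : e * g = e * (g - h) + e * h.
Proof. by rewrite mulrBr subrK. Qed.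

Lemma scale_comb0 (R : pzRingType) (V : lmodType R) (m : V) (u v w g h i : R) :
  g *: m = 0 -> h *: m = 0 -> i *: m = 0 ->
  (u * g + v * h + w * i) *: m = 0.
Proof. by move=> g0 h0 i0; rewrite !scalerDl -!scalerA g0 h0 i0 !scaler0 !addr0. Qed.

Section FreeModuleMaps.
Variables (R : pzRingType) (V : lmodType R).

Lemma linear_on_pairs (g : {linear (R^o * R^o)%type -> V}) (a b : R) :
  g (a, b) = a *: g (1, 0) + b *: g (0, 1).
Proof.
rewrite -!linearZ -linearD; congr (g _).
by apply: injective_projections; rewrite /= !scaler0 ?addr0 ?add0r; apply/esym/mulr1.
Qed.

Definition comb3 (m1 m2 m3 : V) (s : R^o * R^o * R^o) : V :=
  (s.1.1 : R) *: m1 + (s.1.2 : R) *: m2 + (s.2 : R) *: m3.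

Lemma comb3_linear m1 m2 m3 : linear (comb3 m1 m2 m3).
Proof.
move=> c [[u v] w] [[u' v'] w']; rewrite /comb3 /=.
have lin1 (a a' : R) (m : V) : (c * a + a') *: m = c *: (a *: m) + a' *: m.
  by rewrite scalerDl scalerA.
by rewrite !lin1 !scalerDr (addrACA (c *: _)) (addrACA (c *: _ + _)).
Qed.

(** Pulls a 2-cochain with values [m1], [m2], [m3] back along [D3], collecting the coefficients of
    [a] and [b] for comparison with a 3-cocycle. *)
Lemma comb3_D3 (a b g h g' h' i : R) (m1 m2 m3 : V) :
  - (b * i) *: m1 + (b * (g + h) - a * h') *: m2 + (a * g') *: m3 =
  a *: (g' *: m3 - h' *: m2) + b *: (g *: m2 + h *: m2 - i *: m1).
Proof.
rewrite scaleNr scalerBl mulrDr scalerDl !scalerBr scalerDr !scalerA.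
by rewrite addrA (addrC (- _)) [LHS]addrAC [RHS]addrC [RHS]addrA.
Qed.

End FreeModuleMaps.

Section Resolution.
Variables (k : fieldType).
Local Notation A := (algA k).
Local Notation E := (enveloping A).
Local Notation M := (regular_bimodule A).
Variable C : contraction E.
Hypotheses (clE : cl C = @lE k) (crE : cr C = @rE k).

(** The multiplication map [a (x) b |-> a * b], written as the action on 1. *)
Definition aug (e : E^o) : M := (e : E) *: ((1 : A) : M).

Lemma aug_linear : linear aug.
Proof. by move=> c u v; rewrite /aug scalerDl -scalerA. Qed.

Lemma lE_act i (m : M) : (cl C i : E) *: m = genA k i * (m : A) :> A.
Proof. by rewrite clE [LHS]bimodule_act_tens mulr1. Qed.

Lemma rE_act i (m : M) : (cr C i : E) *: m = (m : A) * genA k i :> A.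
Proof. by rewrite crE [LHS]bimodule_act_tens mul1r. Qed.

Lemma aug_tens (a : A) (b : A^c) : aug (tens a b : E) = a * (b : A) :> A.
Proof. by rewrite [LHS]bimodule_act_tens mulr1. Qed.

Lemma augD1 s : aug (D1 C s) = 0.
Proof.
case: s => [[u v] w]; rewrite /aug /D1.
have comm0 i : (cl C i - cr C i : E) *: ((1 : A) : M) = 0.
  by rewrite scalerBl lE_act rE_act mulr1 mul1r subrr.
by apply: scale_comb0; apply: comm0.
Qed.

Lemma D1_gen (u : E) i : exists s, D1 C s = u * (cl C i - cr C i).
Proof.
case: i => [[|[|[|?]]] p] //.
- exists (u, 0, 0); rewrite /D1 !mul0r !addr0; congr (_ * (cl C _ - cr C _));
    exact: val_inj.
- exists (0, u, 0); rewrite /D1 !mul0r add0r addr0; congr (_ * (cl C _ - cr C _));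
    exact: val_inj.
exists (0, 0, u); rewrite /D1 !mul0r !add0r; congr (_ * (cl C _ - cr C _));
    exact: val_inj.
Qed.

(** Modulo the image of [D1], right multiplication by [cl i] and by [cr i] agree, so the letters of
    [a] move one by one, starting with the last, to the right factor. *)
Lemma tens_mod_D1 (a : A) (b : A^c) :
  exists s, tens a b = D1 C s + tens 1 (a * (b : A) : A^c) :> E.
Proof.
elim/algA_rind: a b => [c a a' IH IH'||a i IH] b.
- have [s sE] := IH (c *: b); have [t tE] := IH' b.
  exists (s + t); rewrite tensDl tensZ sE tE D1D addrACA -tensDr.
  by congr (_ + tens 1 _); rewrite mulrDl -scalerAl -scalerAr.
- exists (0, 0, 0); rewrite mul1r -[LHS]add0r; congr (_ + _).
  by rewrite /D1 !mul0r !addr0.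
have [s sE] := IH (genA k i * (b : A)).
have [t tE] := D1_gen (tens a b) i.
have lE1 : tens a b * cl C i = tens (a * genA k i) b.
  by rewrite clE; apply: tens_mul1r.
have rE1 : tens a b * cr C i = tens a (genA k i * (b : A) : A^c).
  by rewrite crE; apply: tens_mulr1.
exists (t + s).
rewrite D1D -addrA -mulrA -sE tE; apply: etrans (esym lE1) _.
apply: etrans (mulr_split _ _ (cr C i)) _.
exact: (congr1 (+%R _) rE1).
Qed.

Lemma aug_exact u : aug u = 0 -> exists s, D1 C s = u.
Proof.
(* Modulo boundaries every [u] is [1 (x) aug u], which vanishes with [aug u]. *)
suff [s sE] : exists s, u = D1 C s + tens 1 (aug u : A^c) :> E.
  by move=> u0; exists s; rewrite [RHS]sE u0 tens0r addr0.
elim/tensor_ind: u => [u v [s sE] [t tE]|a b].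
  exists (s + t); rewrite D1D {1}sE {1}tE addrACA -tensDr; congr (_ + tens 1 _).
  by rewrite /aug scalerDl.
by have [s sE] := tens_mod_D1 a b; exists s; rewrite aug_tens.
Qed.

(** Row vectors of length 0 provide the zero module in degrees above 4. *)
Definition Kmod (n : nat) : lmodType E :=
  match n with
  | 0 | 4 => E^o
  | 1 | 2 => (E^o * E^o * E^o)%type
  | 3 => (E^o * E^o)%type
  | _ => 'rV[E]_0
  end.

Definition Kd (n : nat) : {linear Kmod n.+1 -> Kmod n} :=
  match n return {linear Kmod n.+1 -> Kmod n} with
  | 0 => linear_of (@D1_linear _ C)
  | 1 => linear_of (@D2_linear _ C)
  | 2 => linear_of (@D3_linear _ C)
  | 3 => linear_of (@D4_linear _ C)
  | _ => \0
  end.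

Lemma Kmod_trivial n (u : Kmod n.+4.+1) : u = 0.
Proof. exact: (thinmx0 (u : 'rV[E]_0)). Qed.

Lemma Kmod_proj n : projective (Kmod n).
Proof.
case: n => [|[|[|[|[|n]]]]]; last exact/projective_trivial/Kmod_trivial.
all: by do ?[apply: projective_prod]; apply: projective_regular.
Qed.

Lemma Kexact n p : Kd n p = 0 <-> exists q, Kd n.+1 q = p.
Proof.
case: n p => [|[|[|[|n]]]] p; split.
- exact: D1_exact.
- by case=> q <-; apply: D12.
- exact: D2_exact.
- by case=> q <-; apply: D23.
- exact: D3_exact.
- by case=> q <-; apply: D34.
- by move=> /D4_inj->; exists 0.
- by case=> q <-; apply: (linear0 (linear_of (@D4_linear _ C))).
- by move=> _; exists 0; rewrite [p]Kmod_trivial.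
- by [].
Qed.

Lemma Kaug_exact p : linear_of aug_linear p = 0 <-> exists q, Kd 0 q = p.
Proof. by split=> [/aug_exact|[s <-]] //; apply: augD1. Qed.

Lemma Kaug_surj m : exists p, linear_of aug_linear p = m.
Proof. by exists (tens (m : A) 1); rewrite [LHS]aug_tens mulr1. Qed.

Definition koszul_resolution : proj_resolution M :=
  @ProjResolution E M Kmod Kd (linear_of aug_linear) Kmod_proj Kaug_surj
    Kaug_exact Kexact.

End Resolution.

Theorem proposition3p9 (k : fieldType) (char_k : [pchar k] =i pred0)
    (n : nat) (hn : n \notin [:: 0; 1; 2; 4]%N) :
  HH_vanishes (algA k) n.
Proof.
move=> P f; have [Q] := right_quotients_exist k.
have [C [clE crE]] : exists C : contraction (enveloping (algA k)),
  cl C = @lE k /\ cr C = @rE k by apply: envelope_contraction Q.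
have transfer m := @ext_vanishing_transfer _ _ (regular_bimodule (algA k))
  (koszul_resolution clE crE) P m.
(* Degree 3 and the degrees from 5 on remain; in the latter the Koszul module is zero. *)
case: n hn f => [|[|[|[|[|n]]]]] // _ f; last first.
  apply: transfer => g _; exists \0 => p.
  by rewrite [p]Kmod_trivial linear0.
apply: transfer => {P f}g g_cocycle.
have [L] := left_quotients_exist k.
have gE a b : g (a, b) = a *: g (1, 0) + b *: g (0, 1) :=
  linear_on_pairs g a b.
have cocycle_eq : (genx k + geny k) * (g (1, 0) : algA k)
    + (g (0, 1) : algA k) * geny k = 0.
  (* On the free generator of degree 4, where [D4] takes the value [(lx + ly, ry)], the cocycle
     condition is the equation solved by [cocycle3_coboundary]. *)
  have := g_cocycle (1 : enveloping (algA k)).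
  rewrite /= /D4 gE !mul1r scalerDl !(lE_act clE) (rE_act crE).
  by rewrite mulrDl.
have [p [q [r [eq1 eq2]]]] := cocycle3_coboundary Q L cocycle_eq.
(* The bounding cochain sends the three generators of degree 2 to [p], [q] and [r]. *)
exists (linear_of (@comb3_linear _ (regular_bimodule (algA k)) p q r)) => -[a b].
rewrite gE [RHS]comb3_D3 !(lE_act clE, rE_act crE); congr (_ *: _ + _ *: _).
  exact: eq1.
by apply: (etrans eq2); congr (_ - _); apply: mulrDl.
Qed.
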